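(* Let $I$ be an arbitrary complete instance of a MAX 2-CSP (or BFOP) problem with $n$ variables and $m$ constraints (functions), whose weights are independent random variables in $[-1,1]$, each with density at most $\phi>0$. Then, with probability at least $1-o_n(1)$ over the draw of the weights, every implementation of the 2-FLIP algorithm running on $I$ terminates after at most $m\,\phi\, n^{O(\log^{10} n)}$ steps.
   Context: A BFOP (binary function optimization problem) instance consists of variables $x_1,\dots,x_n$ with domain $\{-1,1\}$, functions $f_1,\dots,f_m$, each $f_i$ a function of one or two of the variables taking values in $\{0,1,\dots,d\}$ for a fixed constant $d$, and weights $w_1,\dots,w_m$; the objective of an assignment $\tau$ is $\sum_i w_i f_i(\tau)$ and is to be maximized. A MAX 2-CSP instance is the special case where each $f_i$ is a predicate ($\{0,1\}$-valued) on a pair of variables, i.e. the objective is the total weight of satisfied constraints. A binary function $f(x,y)$ is separable if $f(x,y)=f_1(x)+f_2(y)$ for some unary $f_1,f_2$ (equivalently $f(-1,-1)+f(1,1)=f(-1,1)+f(1,-1)$), and nonseparable otherwise; separable binary functions are regarded as replaced by the corresponding unary functions. The instance is complete if every pair of distinct variables is the pair of arguments of at least one nonseparable binary function of the instance. The 2-FLIP algorithm starts from an arbitrary assignment and, while some assignment differing in at most two variables has strictly larger objective, moves to one such assignment chosen by an arbitrary pivoting rule, except that it never flips two variables when flipping only one of them would give a strictly larger objective; a step is one such move. *)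

(* Defs.v *)
From HB Require Import structures.
From mathcomp Require Import all_boot all_order all_algebra.
From mathcomp Require Import all_classical all_reals all_analysis.

Set Implicit Arguments.
Unset Strict Implicit.
Unset Printing Implicit Defensive.

Import Order.TTheory GRing.Theory Num.Theory.
Import numFieldNormedType.Exports.

Local Open Scope classical_set_scope.
Local Open Scope ring_scope.

(* The domain {-1, 1} is represented by [bool], with [false] for -1 and [true]
   for 1; the range {0, ..., d} is ['I_d.+1]. *)
Definition assignment (n : nat) := {ffun 'I_n -> bool}.

Inductive bfop_fun (n d : nat) : Type :=
| Unary (x : 'I_n) (g : bool -> 'I_d.+1)
| Binary (x y : 'I_n) (neq_xy : x != y) (g : bool -> bool -> 'I_d.+1).

(* A MAX 2-CSP instance is the case [d = 1] with all functions binary. *)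
Definition bfop (n m d : nat) := 'I_m -> bfop_fun n d.

Definition bfop_eval n d (f : bfop_fun n d) (tau : assignment n) : nat :=
  match f with
  | Unary x g => g (tau x)
  | Binary x y _ g => g (tau x) (tau y)
  end.

Definition objective (R : realType) n m d (I : bfop n m d) (w : 'I_m -> R)
    (tau : assignment n) : R :=
  \sum_(i < m) w i * (bfop_eval (I i) tau)%:R.

Definition separable d (g : bool -> bool -> 'I_d.+1) : Prop :=
  exists g1 g2 : bool -> int, forall a b, (g a b)%:Z = g1 a + g2 b.

Definition complete_bfop n m d (I : bfop n m d) : Prop :=
  forall x y : 'I_n, x != y ->
  exists i : 'I_m,
    match I i with
    | Unary _ _ => False
    | Binary u v _ g => [set u; v]%SET = [set x; y]%SET /\ ~ separable g
    end.

Definition flip n (S : {set 'I_n}) (tau : assignment n) : assignment n :=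
  [ffun x => if x \in S then ~~ tau x else tau x].

(* A double flip is excluded when flipping only one of its two variables gives
   a strictly larger objective than flipping both.  In particular, double flips
   that improve the objective when neither single flip does are allowed. *)
Definition two_flip_step (R : realType) n m d (I : bfop n m d) (w : 'I_m -> R)
    (tau tau' : assignment n) : bool :=
  [exists S : {set 'I_n},
    [&& (0 < #|S| <= 2)%N,
        tau' == flip S tau,
        objective I w tau < objective I w tau' &
        (#|S| == 2)%N ==>
          [forall x in S,
            objective I w (flip [set x]%SET tau) <= objective I w tau']]].

(* A pivoting rule may depend on the history in any way, so the executions of
   all implementations are the sequences of consecutive steps. *)
Definition two_flip_within (R : realType) n m d (I : bfop n m d)
    (w : 'I_m -> R) (B : R) : Prop :=
  forall (tau0 : assignment n) (s : seq (assignment n)),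
    path (two_flip_step I w) tau0 s -> (size s)%:R <= B.

Definition mutually_independent (disp : measure_display)
    (T : measurableType disp) (R : realType) (P : probability T R) (m : nat)
    (X : 'I_m -> {RV P >-> R}) : Prop :=
  forall (J : {set 'I_m}) (A : 'I_m -> set R),
    (forall i, measurable (A i)) ->
    P (\bigcap_(i in [set` J]) (X i @^-1` A i)) =
      (\prod_(i in J) P (X i @^-1` A i))%E.

Definition is_density (disp : measure_display)
    (T : measurableType disp) (R : realType) (P : probability T R)
    (X : {RV P >-> R}) (p : R -> R) : Prop :=
  [/\ measurable_fun setT p,
      forall x, 0 <= p x &
      forall A : set R, measurable A ->
        distribution P X A = (\int[lebesgue_measure]_(x in A) (p x)%:E)%E].

Definition density_at_most (disp : measure_display)
    (T : measurableType disp) (R : realType) (P : probability T R)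
    (X : {RV P >-> R}) (phi : R) : Prop :=
  exists2 p : R -> R, is_density X p & forall x, p x <= phi.

(* Main.v *)
(* Add to the [n] variables a virtual one that stores the parity of the assignment,
   so that every move flips exactly two coordinates, i.e. is an edge of a
   multigraph on [n + 1] vertices.  An integer combination of moves in which each
   variable is flipped zero times in total (a circulation) has an objective gain
   that no longer involves unary terms: it is an integer linear form in the weights
   of the binary functions.  Assignments do not repeat along an execution, because
   the objective increases; hence any two moves at a vertex [x] are told apart by
   some variable [y], and combining such pairs of moves along short circulations of
   the multigraph gives, in every block of order [n log n] moves, a window of length
   [b] with order [b / log^3 n] circulations of length and coefficients [O(log n)],
   whose forms have pivot weights (those of the pairs [x], [y]) that appear in no
   other of these forms.  All of them are at most [eta] in absolute value with
   probability at most [(4 eta phi) ^ r], [r] being their number, while a window of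
   length [b] is determined up to irrelevant data by one of [(4 n^2) ^ b] words.  So
   for [eta] of order [n ^ (- O(log^3 n)) / phi] all blocks of all executions gain
   at least [eta / O(log n)] with high probability, and the objective ranges over an
   interval of length [2 m d]. *)
Require Import Defs.
From HB Require Import structures.
From mathcomp Require Import all_boot all_order all_algebra.
From mathcomp Require Import zify ring lra.
From mathcomp Require Import boolp.

Set Implicit Arguments.
Unset Strict Implicit.
Unset Printing Implicit Defensive.

Import Order.TTheory GRing.Theory Num.Theory.
Local Open Scope ring_scope.

(** * Random colourings *)

Lemma exists_le_average (C : finType) (f : C -> nat) (M : nat) :
  (0 < #|C|)%N -> (\sum_c f c <= #|C| * M)%N -> exists c, (f c <= M)%N.
Proof.
move=> C0 le_sum; case: (boolP [exists c, f c <= M]%N) => [/existsP//|].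
rewrite negb_exists => /forallP lt_f.
have : (\sum_(c : C) M.+1 <= \sum_c f c)%N.
  by apply: leq_sum => c _; rewrite ltnNge lt_f.
by rewrite sum_nat_const mulnS leqNgt (leq_ltn_trans le_sum) // -[ltnLHS]add0n ltn_add2r.
Qed.

(** Overwriting the value at [u] by a free colour is a bijection from pairs of a constrained
    colouring and a colour onto all colourings. The twist [pi] lets the same count serve random
    gauges. *)
Lemma card_constrained_coloring (V K : finType) (pi : K -> K) (u v : V) :
  u != v ->
  (#|[set c : {ffun V -> K} | c u == pi (c v)]| * #|K| = #|{ffun V -> K}|)%N.
Proof.
move=> neq_uv; set A := finset _.
pose upd (ck : {ffun V -> K} * K) : {ffun V -> K} :=
  [ffun x => if x == u then ck.2 else ck.1 x].
have inj : {in setX A [set: K] &, injective upd}.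
  move=> [c k] [c' k']; rewrite !inE /= !andbT => /eqP cA /eqP c'A e.
  have e' x := congr1 (fun f : {ffun V -> K} => f x) e.
  have ck : k = k' by move: (e' u); rewrite !ffunE eqxx.
  have cE x : x != u -> c x = c' x.
    by move=> xu; move: (e' x); rewrite !ffunE (negPf xu).
  congr pair => //; apply/ffunP => x; case: (eqVneq x u) => [->|/cE//].
  by rewrite cA c'A cE // eq_sym.
rewrite -cardsT -cardsX -(card_in_imset inj) -cardsT; congr #|pred_of_set _|.
apply/setP => f; rewrite inE; apply/imsetP.
exists ([ffun x => if x == u then pi (f v) else f x], f u).
  by rewrite !inE !ffunE eqxx /= [v == u]eq_sym (negPf neq_uv) eqxx.
by apply/ffunP => x; rewrite !ffunE; case: eqP => [->|].
Qed.

(** A fixed pair of distinct vertices clashes in a fraction [1 / #|K|] of all colourings; sum over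
    the at most [p] pairs of each element and average. *)
Lemma exists_coloring (V E K : finType) (I : {set E}) (ps : E -> seq (V * V))
    (p : nat) :
  (0 < #|K|)%N ->
  (forall e, e \in I -> (size (ps e) <= p)%N /\ all (fun q => q.1 != q.2) (ps e)) ->
  exists c : {ffun V -> K},
    (#|K| * #|[set e in I | has (fun q => c q.1 == c q.2) (ps e)]| <= p * #|I|)%N.
Proof.
move=> K0 hps; apply: exists_le_average.
  by rewrite card_ffun expn_gt0 K0.
rewrite -big_distrr /=.
have -> : (\sum_(c : {ffun V -> K}) #|[set e in I | has (fun q => c q.1 == c q.2) (ps e)]|
  = \sum_(e in I) \sum_(c : {ffun V -> K}) has (fun q => c q.1 == c q.2) (ps e))%N.
  rewrite exchange_big /=; apply: eq_bigr => c _.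
  rewrite -sum1_card big_mkcond [RHS]big_mkcond /=; apply: eq_bigr => e _.
  by rewrite inE; case: (e \in I) => //=; case: has.
rewrite mulnC big_distrl /=.
apply: (@leq_trans (\sum_(e in I) p * #|{ffun V -> K}|)); last first.
  by rewrite sum_nat_const; lia.
apply: leq_sum => e eI; have [sz /allP neq] := hps _ eI.
apply: (@leq_trans (size (ps e) * #|{ffun V -> K}|)); last by rewrite leq_mul2r sz orbT.
elim: (ps e) neq {sz} => [|q s IHs] neq; first by rewrite big1.
apply: (@leq_trans ((\sum_(c : {ffun V -> K}) ((c q.1 == c q.2) : nat)
   + \sum_(c : {ffun V -> K}) (has (fun q => c q.1 == c q.2) s : nat)) * #|K|)).
  rewrite leq_mul2r -big_split /= leq_sum ?orbT // => c _.
  by case: (c q.1 == _); case: has.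
rewrite mulnDl [size _]/= mulSn leq_add //; last first.
  by apply: IHs => x xs; apply: neq; rewrite inE xs orbT.
rewrite -(@card_constrained_coloring V K id q.1 q.2); last by apply: neq; rewrite mem_head.
rewrite leq_mul2r -sum1_card [leqRHS]big_mkcond /= leq_sum ?orbT // => c _.
by rewrite inE; case: eqP.
Qed.

(** * Short circulations in dense graphs *)

Section Flow.
Variables (V E : finType) (al be : E -> V).

Definition boundary (p : E -> int) (v : V) : int :=
  \sum_f p f * ((be f == v)%:R - (al f == v)%:R).

Lemma boundaryD p q v :
  boundary (fun f => p f + q f) v = boundary p v + boundary q v.
Proof. by rewrite -big_split; apply: eq_bigr => f _ /=; rewrite mulrDl. Qed.

Lemma boundaryN p v : boundary (fun f => - p f) v = - boundary p v.
Proof. by rewrite -sumrN; apply: eq_bigr => f _ /=; rewrite mulNr. Qed.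

(** One unit sent along [e] towards its end [w]; the sign corrects for the orientation of [e]. *)
Definition edge_flow (e : E) (w : V) (f : E) : int :=
  if f == e then (if be e == w then 1 else -1) else 0.

Lemma boundary_edge_flow e a w v : al e != be e ->
  ((al e == a) && (be e == w)) || ((al e == w) && (be e == a)) ->
  boundary (edge_flow e w) v = (w == v)%:R - (a == v)%:R.
Proof.
move=> neq ends; rewrite /boundary (bigD1 e) //= big1 ?addr0; last first.
  by move=> f /negPf fe; rewrite /edge_flow fe mul0r.
rewrite /edge_flow eqxx; case/orP: ends => /andP[/eqP <- /eqP <-].
  by rewrite eqxx mul1r.
by rewrite eq_sym (negPf neq) mulN1r opprB.
Qed.

Lemma norm_edge_flow e w : \sum_f `|edge_flow e w f| = 1.
Proof.
rewrite (bigD1 e) //= big1 ?addr0 => [|f /negPf fe].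
  by rewrite /edge_flow eqxx; case: ifP.
by rewrite /edge_flow fe normr0.
Qed.

Lemma edge_flow_neq e w f : f != e -> edge_flow e w f = 0.
Proof. by rewrite /edge_flow => /negPf ->. Qed.

Lemma edge_flow_neq0 e w : edge_flow e w e != 0.
Proof. by rewrite /edge_flow eqxx; case: ifP. Qed.

(** As the values are integers, the norm bounds both the coefficients and the size of the
    support. *)
Definition short_circulation (I : {set E}) (k : nat) : Prop :=
  exists p : E -> int,
    [/\ exists2 e, e \in I & p e != 0, forall f, f \notin I -> p f = 0,
        \sum_f `|p f| <= k%:R & forall v, boundary p v = 0].

Section Ball.
Variables (I : {set E}) (H : {set V}) (k : nat).
Hypothesis neq_ends : forall e, e \in I -> al e != be e.
Hypothesis ends_in : forall e, e \in I -> (al e \in H) && (be e \in H).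
Hypothesis expand : forall S : {set V}, S \subset H -> (0 < #|S|)%N ->
  (2 * #|S| <= #|[set e in I | (al e \in S) || (be e \in S)]|)%N.

(** A ball grown from [v0] in [i] rounds: [F] holds its tree edges, with [#|F| < #|S|] standing for
    acyclicity, and [p w] is the unit flow along the tree path from [v0] to [w]. *)
Let tree_ball (v0 : V) (i : nat) : Prop :=
  exists (S : {set V}) (F : {set E}) (p : V -> E -> int),
    [/\ S \subset H, (2 ^ i <= #|S|)%N, F \subset I, (#|F| < #|S|)%N &
        forall w, w \in S ->
          [/\ forall f, f \notin F -> p w f = 0, \sum_f `|p w f| <= i%:R &
              forall v, boundary (p w) v = (w == v)%:R - (v0 == v)%:R]].

(** An edge at [S] that is neither an old nor a new tree edge closes a circulation. If there is
    none, [2 * #|S| <= #|F| + #|N| < #|S| + #|N|], so the ball doubles. *)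
Let tree_ballS v0 i : (i < k)%N -> tree_ball v0 i ->
  short_circulation I (2 * k + 1) \/ tree_ball v0 i.+1.
Proof.
move=> ik [S [F [p [SH cardS FI cardF hp]]]].
set inc := [set e in I | (al e \in S) || (be e \in S)].
(* Going from [v0] to [a], along [e] to [b] and back to [v0] is a circulation, nonzero because
   neither path uses [e]. *)
have cyc e a b (pa pb : E -> int) : e \in I -> al e != be e ->
    ((al e == a) && (be e == b)) || ((al e == b) && (be e == a)) ->
    pa e = 0 -> pb e = 0 ->
    (forall f, f \notin I -> pa f = 0) -> (forall f, f \notin I -> pb f = 0) ->
    \sum_f `|pa f| + \sum_f `|pb f| <= (2 * k)%:R ->
    (forall v, boundary pa v = (a == v)%:R - (v0 == v)%:R) ->
    (forall v, boundary pb v = (b == v)%:R - (v0 == v)%:R) ->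
    short_circulation I (2 * k + 1).
  move=> eI neq ends pa0 pb0 spa spb npab bpa bpb.
  exists (fun f => (pa f + edge_flow e b f) + - pb f); split.
  - by exists e => //; rewrite pa0 pb0 oppr0 add0r addr0 edge_flow_neq0.
  - move=> f fI; rewrite spa // spb // edge_flow_neq ?oppr0 ?addr0 //.
    by apply: contraNneq fI => ->.
  - have : \sum_f `|pa f + edge_flow e b f - pb f| <=
      \sum_f (`|pa f| + `|edge_flow e b f| + `|pb f|).
      apply: ler_sum => f _; rewrite -[`|pb f|]normrN.
      by rewrite (le_trans (ler_normD _ _)) // lerD2r ler_normD.
    move=> /le_trans; apply; rewrite !big_split /= norm_edge_flow.
    by rewrite natrD addrAC lerD2r.
  - move=> v; rewrite boundaryD boundaryN boundaryD bpa bpb.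
    by rewrite (boundary_edge_flow _ neq ends); ring.
pose N := [set w in H :\: S | [exists e in I, exists a in S,
   ((al e == a) && (be e == w)) || ((al e == w) && (be e == a))]].
have /fin_all_exists [tau htau] w : exists q : E * V, w \in N ->
    [/\ q.1 \in I, q.2 \in S &
     ((al q.1 == q.2) && (be q.1 == w)) || ((al q.1 == w) && (be q.1 == q.2))].
  case: (boolP (w \in N)) => wN.
    move: wN; rewrite inE => /andP[_ /existsP[e /andP[eI /existsP[a /andP[aS h]]]]].
    by exists (e, a).
  (* Outside [N] any pair serves as default value; one exists because an empty [I] would contradict
     [expand]. *)
  case: (set_0Vmem I) => [I0|[e eI]]; last by exists (e, w).
  have /card_gt0P[v vS] : (0 < #|S|)%N by rewrite (leq_trans _ cardS) ?expn_gt0.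
  have := expand SH (leq_ltn_trans (leq0n _) cardF).
  rewrite leqNgt => /negP[]; rewrite (_ : finset _ = set0).
    by rewrite cards0 muln_gt0 /= (cardD1 v) vS.
  by apply/setP => e; rewrite I0 !inE.
pose p' w := if w \in S then p w else
  fun f => p (tau w).2 f + edge_flow (tau w).1 w f.
have NS w : w \in N -> (w \in S) = false.
  by rewrite !inE => /andP[/andP[/negPf]].
have hp' w : w \in N ->
  [/\ forall f, f \notin F -> f != (tau w).1 -> p' w f = 0,
      \sum_f `|p' w f| <= i.+1%:R &
      forall v, boundary (p' w) v = (w == v)%:R - (v0 == v)%:R].
  move=> wN; rewrite /p' NS //; have [tI tS tends] := htau _ wN.
  have [h1 h2 h3] := hp _ tS; split.
  - by move=> f fF ft; rewrite h1 // edge_flow_neq ?addr0.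
  - apply: (@le_trans _ _ (\sum_f (`|p (tau w).2 f| + `|edge_flow (tau w).1 w f|))).
      by apply: ler_sum => f _; apply: ler_normD.
    by rewrite big_split /= norm_edge_flow mulrSr lerD2r.
  - move=> v; rewrite boundaryD h3 (boundary_edge_flow _ (neq_ends tI) tends).
    by ring.
case: (boolP (inc \subset F :|: [set (tau w).1 | w in N])) => [incF|].
  right; exists (S :|: N), (F :|: [set (tau w).1 | w in N]), p'.
  have cardSN : #|S :|: N| = (#|S| + #|N|)%N.
    rewrite cardsU (_ : S :&: N = set0) ?cards0 ?subn0 //.
    by apply/setP => w; rewrite !inE; case: (w \in S).
  have le1 : (#|F :|: [set (tau w).1 | w in N]| <= #|F| + #|N|)%N.
    by rewrite cardsU (leq_trans (leq_subr _ _)) // leq_add2l leq_imset_card.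
  have le2 := leq_trans (expand SH (leq_ltn_trans (leq0n _) cardF)) (subset_leq_card incF).
  split.
  - rewrite subUset SH; apply/subsetP => w; rewrite inE => /andP[].
    by rewrite inE => /andP[].
  - rewrite cardSN expnS; lia.
  - rewrite subUset FI; apply/subsetP => e /imsetP[w wN ->].
    by have [] := htau _ wN.
  - rewrite cardSN; lia.
  - move=> w; rewrite inE; case: (boolP (w \in S)) => /= [wS _|wS wN].
      rewrite /p' wS; have [h1 h2 h3] := hp _ wS; split=> // [f|].
        by rewrite inE negb_or => /andP[/h1].
      by rewrite (le_trans h2) // ler_nat.
    have [h1 h2 h3] := hp' _ wN; split=> // f.
    rewrite inE negb_or => /andP[fF ft]; apply: h1 => //.
    by apply: contraNneq ft => ->; apply: imset_f.
case/subsetPn => e; rewrite inE => /andP[eI eS].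
rewrite !inE negb_or => /andP[eF etau]; left.
have sp w f : w \in S -> f \notin I -> p w f = 0.
  by move=> wS fI; have [-> //] := hp _ wS; apply: contra fI; apply: subsetP.
have sp' w f : w \in N -> f \notin I -> p' w f = 0.
  move=> wN fI; have [-> //] := hp' _ wN.
    by apply: contra fI; apply: subsetP.
  by apply: contraNneq fI => ->; have [] := htau _ wN.
have p'e w : w \in N -> p' w e = 0.
  move=> wN; have [-> //] := hp' _ wN.
  by apply: contraNneq etau => ->; apply: imset_f.
have outer a w : a \in S -> w \in H -> w \notin S ->
    ((al e == a) && (be e == w)) || ((al e == w) && (be e == a)) ->
    short_circulation I (2 * k + 1).
  move=> aS wH wS ends.
  have wN : w \in N.
    rewrite !inE wS wH /=; apply/existsP; exists e; rewrite eI /=.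
    by apply/existsP; exists a; rewrite aS.
  have [h1 h2 h3] := hp _ aS; have [h1' h2' h3'] := hp' _ wN.
  apply: (cyc e a w (p a) (p' w)) => //.
  - exact: neq_ends.
  - exact: h1.
  - exact: p'e.
  - by move=> f; apply: sp.
  - by move=> f; apply: sp'.
  - apply: (le_trans (lerD h2 h2')); rewrite -natrD ler_nat.
    by move: ik; clear; lia.
have /andP[aH bH] := ends_in eI.
case: (boolP (al e \in S)) => aS; last first.
  rewrite (negPf aS) /= in eS.
  by apply: (outer (be e) (al e)) => //; rewrite !eqxx orbT.
case: (boolP (be e \in S)) => bS; last first.
  by apply: (outer (al e) (be e)) => //; rewrite !eqxx.
have [h1 h2 h3] := hp _ aS; have [h1' h2' h3'] := hp _ bS.
apply: (cyc e (al e) (be e) (p (al e)) (p (be e))) => //.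
- exact: neq_ends.
- by rewrite !eqxx.
- exact: h1.
- exact: h1'.
- by move=> f; apply: sp.
- by move=> f; apply: sp.
- apply: (le_trans (lerD h2 h2')); rewrite -natrD ler_nat.
  by move: ik; clear; lia.
Qed.

(** Without a circulation the ball of [k] rounds would outgrow [H]. *)
Lemma expanding_short_circulation :
  (0 < #|H| < 2 ^ k)%N -> short_circulation I (2 * k + 1).
Proof.
case/andP=> /card_gt0P[v0 v0H] Hk.
suff H1 i : (i <= k)%N -> short_circulation I (2 * k + 1) \/ tree_ball v0 i.
  have [//|[S [F [p [SH cardS _ _ _]]]]] := H1 _ (leqnn k).
  by have := leq_trans cardS (subset_leq_card SH); rewrite leqNgt Hk.
elim: i => [_|i IHi ik]; last first.
  have [|] := IHi (ltnW ik); [by left | exact: tree_ballS].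
right; exists [set v0], set0, (fun _ _ => 0); split.
- by rewrite sub1set.
- by rewrite cards1.
- exact: sub0set.
- by rewrite cards0 cards1.
move=> w; rewrite inE => /eqP ->; split=> //.
  by rewrite big1 // => f _; rewrite normr0.
by move=> v; rewrite subrr /boundary big1 // => f _; rewrite mul0r.
Qed.

End Ball.

(* In a vertex-minimal subgraph with at least twice as many edges as vertices,
   every vertex set meets at least twice as many edges as it has vertices, so
   balls double in size until two tree paths close up. *)
Lemma exists_short_circulation (I : {set E}) (H : {set V}) (k : nat) :
  (forall e, e \in I -> al e != be e) ->
  (forall e, e \in I -> (al e \in H) && (be e \in H)) ->
  (0 < #|H| < 2 ^ k)%N -> (2 * #|H| <= #|I|)%N ->
  short_circulation I (2 * k + 1).
Proof.
move=> neq ends Hk HI.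
pose I' (H' : {set V}) := [set e in I | (al e \in H') && (be e \in H')].
pose P (H' : {set V}) := [&& H' \subset H, (0 < #|H'|)%N & (2 * #|H'| <= #|I' H'|)%N].
have PH : P H.
  rewrite /P subxx (_ : I' H = I) ?HI; first by case/andP: Hk => ->.
  by apply/setP => e; rewrite inE; apply: andb_idr => /ends.
case: (arg_minnP (fun H' : {set V} => #|H'|) PH) => H' /and3P[H'H H'0 H'I] minH.
have [||||p [[e eI pe] ps pn pb]] := @expanding_short_circulation (I' H') H' k.
- by move=> e; rewrite inE => /andP[/neq].
- by move=> e; rewrite inE => /andP[].
(* By minimality, deleting a proper part [S] of [H'] leaves fewer than two edges per vertex, so more
   than [2 * #|S|] edges were lost, all of them meeting [S]. *)
- move=> S SH S0.
  have [->|neqS] := eqVneq S H'.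
    apply: (leq_trans H'I); apply/subset_leq_card/subsetP => e.
    by rewrite !inE => /and3P[-> -> ->].
  have cD : (#|S| + #|H' :\: S| = #|H'|)%N by rewrite -[RHS](cardsID S) (setIidPr SH).
  have D0 : (0 < #|H' :\: S|)%N.
    rewrite card_gt0 setD_eq0; apply: contraNN neqS => H'S.
    by rewrite eqEsubset SH.
  have : ~~ P (H' :\: S).
    by apply/negP => /minH; move: S0 cD; lia.
  rewrite /P D0 (subset_trans (subsetDl _ _) H'H) /= -ltnNge => ltI.
  have : (#|I' H'| <= #|[set e in I' H' | (al e \in S) || (be e \in S)]| + #|I' (H' :\: S)|)%N.
    apply: leq_trans (leq_card_setU _ _).1; apply/subset_leq_card/subsetP => e.
    rewrite !inE => /and3P[-> -> ->] /=; case: (al e \in S) => //=; by case: (be e \in S).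
  by move: H'I cD ltI; lia.
- by case/andP: Hk => _; rewrite H'0; apply: leq_ltn_trans (subset_leq_card H'H).
exists p; split=> //; first by exists e => //; move: eI; rewrite inE => /andP[].
by move=> f fI; apply: ps; rewrite inE negb_and fI.
Qed.

End Flow.

(* [H] maximizes [\sum_(x in T) minn 2 #|nb x :&: H| - q * #|H|]. *)
Lemma exists_hubs (V : finType) (U T : {set V}) (nb : V -> {set V}) (q D : nat) :
  T \subset U -> (forall x, x \in T -> nb x \subset U /\ (D < #|nb x|)%N) ->
  exists H : {set V}, [/\ H \subset U, (q * #|H| <= 2 * #|T|)%N &
    (#|[set x in T | (#|nb x :&: H| <= 1)%N]| * D <= q * #|U|)%N].
Proof.
move=> TU hnb.
pose psi (H : {set V}) := (\sum_(x in T) minn 2 #|nb x :&: H|)%N.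
pose F (H : {set V}) := (psi H + q * #|U :\: H|)%N.
have [H HU maxH] : exists2 H : {set V}, H \subset U &
    forall H' : {set V}, H' \subset U -> (F H' <= F H)%N.
  have P0 : (set0 : {set V}) \subset U by apply: sub0set.
  by case: (@arg_maxnP _ set0 (fun H : {set V} => H \subset U) F P0) => H; exists H.
exists H; split=> //.
  have := maxH _ (sub0set U); rewrite /F setD0.
  have : (psi H <= 2 * #|T|)%N.
    by rewrite /psi mulnC -sum_nat_const leq_sum // => x _; apply: geq_minl.
  have -> : (#|U| = #|H| + #|U :\: H|)%N by rewrite -[LHS](cardsID H) (setIidPr HU).
  by move: (psi H) (psi set0) #|T| #|H| #|U :\: H|; clear; nia.
set B := finset _.
(* Moving [v] into [H] costs [q] and gains one for each [x] in [B] with [v] in [nb x]; maximality of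
   [H] bounds their number. *)
have gain v : v \in U :\: H -> (#|[set x in B | v \in nb x]| <= q)%N.
  rewrite inE => /andP[vH vU].
  have := maxH (v |: H); rewrite subUset sub1set vU HU => /(_ isT).
  rewrite /F; have -> : (#|U :\: H| = #|U :\: (v |: H)|.+1)%N.
    by rewrite (cardsD1 v) !inE vH vU setDDl setUC.
  suff : (psi H + #|[set x in B | v \in nb x]| <= psi (v |: H))%N.
    by move: (psi H) (psi _) #|_| #|_|; clear; lia.
  rewrite /psi -sum1_card big_mkcond /= [X in (_ + X)%N]big_mkcond /= [leqRHS]big_mkcond /=.
  rewrite -big_split leq_sum // => x _; rewrite !inE.
  case: (x \in T) => //=.
  have sub : (#|nb x :&: H| <= #|nb x :&: (v |: H)|)%N.
    by apply/subset_leq_card/setIS/subsetUr.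
  case: (leqP #|nb x :&: H| 1) => /= small; last first.
    by move: sub small; move: #|_| #|_|; clear; lia.
  case: (boolP (v \in nb x)) => vx; last by move: sub small; move: #|_| #|_|; clear; lia.
  suff : (#|nb x :&: H| < #|nb x :&: (v |: H)|)%N.
    by move: small; move: #|_| #|_|; clear; lia.
  apply: proper_card; rewrite properEneq setIS ?subsetUr // andbT.
  by apply/eqP => /setP/(_ v); rewrite !inE vx (negPf vH) eqxx.
(* Double counting of the pairs of [x] in [B] and [v] in [nb x :\: H]: every [x] has at least [D] of
   them, every [v] at most [q]. *)
apply: (@leq_trans (\sum_(x in B) #|nb x :\: H|)).
  rewrite -sum_nat_const leq_sum // => x; rewrite inE => /andP[xT small].
  have [_] := hnb _ xT; rewrite -(cardsID H (nb x)).
  by move: small; move: #|_| #|_|; clear; lia.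
apply: (@leq_trans (\sum_(v in U :\: H) #|[set x in B | v \in nb x]|)).
  rewrite (eq_bigr (fun x => \sum_(v in U :\: H | v \in nb x) 1)%N).
    rewrite (exchange_big_dep (fun v => v \in U :\: H)) /=; last by move=> x v _ /andP[].
    apply: leq_sum => v vUH; rewrite sum1_card; apply/eq_leq/eq_card => x.
    by move: vUH; rewrite !inE => vUH; rewrite unfold_in vUH !inE.
  move=> x; rewrite inE => /andP[xT _]; rewrite sum1_card; apply: eq_card => v.
  have [/subsetP sub _] := hnb _ xT.
  rewrite [RHS]unfold_in !inE; case: (boolP (v \in nb x)) => [/sub ->|_]; by rewrite ?andbT ?andbF.
apply: (@leq_trans (\sum_(v in U :\: H) q)); first by apply: leq_sum.
rewrite sum_nat_const mulnC leq_mul2l subset_leq_card ?orbT //.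
exact: subsetDl.
Qed.

(** * Walks in the hypercube *)

Section Harmonic.
Variable R : realFieldType.

Definition harmonic_sum (u : nat) : R := \sum_(0 <= k < u) k.+1%:R^-1.

Lemma harmonic_sumS u : harmonic_sum u.+1 = harmonic_sum u + u.+1%:R^-1.
Proof. by rewrite /harmonic_sum big_nat_recr. Qed.

Lemma harmonic_sum_ge0 u : 0 <= harmonic_sum u.
Proof. by apply: sumr_ge0 => k _; rewrite invr_ge0. Qed.

Lemma harmonic_sum_le u k : (u < 2 ^ k)%N -> harmonic_sum u <= k%:R.
Proof.
elim: k u => [|k IHk] u.
  by rewrite expn0 ltnS leqn0 => /eqP ->; rewrite /harmonic_sum big_geq.
rewrite expnS => Hu.
have pos : (0 < 2 ^ k)%N by rewrite expn_gt0.
have [small|big] := ltnP u (2 ^ k); first by rewrite (le_trans (IHk _ small)) // ler_nat.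
rewrite /harmonic_sum (big_cat_nat (n := (2 ^ k).-1)) //=; last by lia.
rewrite -[k.+1]addn1 natrD lerD //; first by apply: IHk; lia.
apply: (@le_trans _ _ (\sum_((2 ^ k).-1 <= i < u) (2 ^ k)%:R^-1)).
  rewrite big_nat_cond [leRHS]big_nat_cond; apply: ler_sum => i.
  rewrite andbT => /andP[h _]; rewrite lef_pV2 ?posrE ?ltr0n // ler_nat; lia.
rewrite sumr_const_nat -[_ *+ _]mulr_natl ler_pdivrMr ?ltr0n // mul1r ler_nat; lia.
Qed.

(** The threshold of [exists_dense_window] runs from one sixteenth up to at most one eighth, the
    proportion of kept moves provided by [exists_gauge]. *)
Lemma harmonic_sum_threshold u k : (0 < k)%N -> (u < 2 ^ k)%N ->
  16%:R^-1 + harmonic_sum u / (16 * k)%:R <= 8%:R^-1.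
Proof.
move=> k0 /harmonic_sum_le hu.
have : harmonic_sum u / (16 * k)%:R <= 16%:R^-1.
  by rewrite ler_pdivrMr ?ltr0n ?muln_gt0 ?k0 // natrM mulKf ?pnatr_eq0.
lra.
Qed.

End Harmonic.

Section Walk.
Variables (V : finType) (z0 : V) (tau : nat -> V -> bool) (e1 e2 : nat -> V).
Variable l : nat.
Hypothesis neq_ends : forall t, (t < l)%N -> e1 t != e2 t.
Hypothesis step : forall t v, (t < l)%N ->
  tau t.+1 v = tau t v (+) ((v == e1 t) || (v == e2 t)).
Hypothesis tau_inj : forall s t, (s <= l)%N -> (t <= l)%N ->
  tau s =1 tau t -> s = t.

Lemma walk_parity t : (t <= l)%N ->
  \big[addb/false]_v tau t v = \big[addb/false]_v tau 0 v.
Proof.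
elim: t => [//|t IHt] tl; rewrite -IHt 1?ltnW //.
under eq_bigr do rewrite step //.
rewrite big_split /= [X in _ (+) X](_ : _ = false) ?addbF //.
rewrite (bigD1 (e1 t)) //= (bigD1 (e2 t)) /=; last by rewrite eq_sym neq_ends.
rewrite big1 => [|v /andP[/negPf -> /negPf -> //]].
by rewrite !eqxx orbT.
Qed.

Definition edge_at (t : nat) (u x : V) : bool :=
  ((e1 t == u) && (e2 t == x)) || ((e1 t == x) && (e2 t == u)).

Lemma edge_atC t u x : edge_at t u x = edge_at t x u.
Proof. by rewrite /edge_at orbC. Qed.

Lemma step_edge t u x v : (t < l)%N -> edge_at t u x ->
  tau t.+1 v = tau t v (+) ((v == u) || (v == x)).
Proof.
move=> tl; rewrite step // => /orP[] /andP[/eqP -> /eqP ->] //.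
by rewrite orbC.
Qed.

Lemma edge_at_neq t u x : (t < l)%N -> edge_at t u x -> u != x.
Proof.
move=> tl /orP[] /andP[/eqP <- /eqP <-]; first exact: neq_ends.
by rewrite eq_sym neq_ends.
Qed.

Variables (eps : V -> bool) (g : bool).

(* In the gauge [eps], a kept move swaps a 0 and a 1.  Keeping only even times
   ensures that two distinct kept moves are not consecutive. *)
Definition kept (t : nat) : bool :=
  [&& ~~ odd t, tau t z0 == g &
      tau t (e1 t) (+) eps (e1 t) != tau t (e2 t) (+) eps (e2 t)].

Lemma kept_swap t u x : kept t -> edge_at t u x ->
  tau t u (+) eps u = ~~ (tau t x (+) eps x).
Proof.
case/and3P=> _ _ neq /orP[] /andP[/eqP <- /eqP <-]; move: neq;
  by do 2 case: (_ (+) _).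
Qed.

Lemma big_addb_support (f : V -> bool) (S : {set V}) :
  (forall v, v \notin S -> f v = false) ->
  \big[addb/false]_v f v = \big[addb/false]_(v in S) f v.
Proof.
move=> fS; rewrite (bigID (mem S)) /= [X in _ (+) X]big1 ?addbF //.
Qed.

(** Without such a [y] the assignments at [s] and [t] differ only on [u], [x], [w], and by parity on
    an even number of them. In every case one of [tau s], [tau s.+1] equals one of [tau t],
    [tau t.+1]; as [s] and [t] are even and distinct, this contradicts [tau_inj]. *)
Lemma kept_witness s t u x w : (s < l)%N -> (t < l)%N -> s != t ->
  kept s -> kept t -> edge_at s u x -> edge_at t x w ->
  exists y, [/\ y != u, y != x, y != w, y != z0 & tau s y != tau t y].
Proof.
move=> sl tl st ks kt es et.
case: (boolP [exists y, [&& y != u, y != x, y != w, y != z0 & tau s y != tau t y]]).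
  by case/existsP=> y /and5P[*]; exists y.
rewrite negb_exists => /forallP same0.
have same y : y != u -> y != x -> y != w -> tau s y = tau t y.
  move=> yu yx yw; have := same0 y; rewrite yu yx yw /=.
  have [-> _|_ /=] := eqVneq y z0; last by rewrite negbK => /eqP.
  (* Kept moves start with the same value [g] at [z0], so [z0] never is the only difference. *)
  by have [[/and3P[_ /eqP -> _] /and3P[_ /eqP -> _]]] := (ks, kt).
have ux := edge_at_neq sl es; have xw := edge_at_neq tl et.
have swaps := kept_swap ks es; have swapt := kept_swap kt et.
have evs : ~~ odd s by case/and3P: ks.
have evt : ~~ odd t by case/and3P: kt.
have contra00 : ~ (tau s =1 tau t).
  by move/(tau_inj (ltnW sl) (ltnW tl))/eqP; rewrite (negPf st).
have contra10 : ~ (tau s.+1 =1 tau t).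
  by move/(tau_inj sl (ltnW tl)) => h; move: evt; rewrite -h /= evs.
have contra01 : ~ (tau s =1 tau t.+1).
  by move/(tau_inj (ltnW sl) tl) => h; move: evs; rewrite h /= evt.
have contra11 : ~ (tau s.+1 =1 tau t.+1).
  by move/(tau_inj sl tl)/succn_inj/eqP; rewrite (negPf st).
have par : \big[addb/false]_(v in [set u; x; w]) (tau s v (+) tau t v) = false.
  rewrite -big_addb_support => [|v]; last first.
    rewrite !inE !negb_or => /andP[/andP[? ?] ?].
    by rewrite same // addbb.
  by rewrite big_split /= !walk_parity 1?ltnW // addbb.
have [uw|uw] := eqVneq u w.
  subst w; move: par; rewrite (_ : [set u; x; u] = u |: [set x]); last first.
    by apply/setP => v; rewrite !inE orbAC orbb.
  rewrite big_setU1 ?inE //= big_set1 => par.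
  case Eu : (tau s u (+) tau t u).
    exfalso; apply: contra10 => v; rewrite (step_edge _ sl es).
    have [->|vu] := eqVneq v u; first by move: Eu; do 2 case: (tau _ u).
    have [->|vx] := eqVneq v x.
      by move: par; rewrite Eu; do 2 case: (tau _ x).
    by rewrite addbF same.
  exfalso; apply: contra00 => v.
  have [->|vu] := eqVneq v u; first by move: Eu; do 2 case: (tau _ u).
  have [->|vx] := eqVneq v x; first by move: par; rewrite Eu; do 2 case: (tau _ x).
  exact: same.
move: par; rewrite -setUA big_setU1 ?inE ?negb_or ?ux ?uw //=.
rewrite big_setU1 ?inE //= big_set1 => par.
exfalso.
have stps := step_edge _ sl es; have stpt := step_edge _ tl et.
case Eu : (tau s u (+) tau t u); case Ex : (tau s x (+) tau t x).
- apply: contra10 => v; rewrite stps.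
  have [->|vu] := eqVneq v u; first by move: Eu; do 2 case: (tau _ u).
  have [->|vx] := eqVneq v x; first by move: Ex; do 2 case: (tau _ x).
  rewrite addbF; have [->|vw] := eqVneq v w; last exact: same.
  by move: par; rewrite Eu Ex; do 2 case: (tau _ w).
- apply: contra11 => v; rewrite stps stpt.
  have [->|vu] := eqVneq v u.
    rewrite (negPf ux) (negPf uw) /= addbF.
    by move: Eu; do 2 case: (tau _ u).
  have [->|vx] := eqVneq v x; first by move: Ex; do 2 case: (tau _ x).
  rewrite addbF; have [->|vw] /= := eqVneq v w; last by rewrite addbF same.
  by move: par; rewrite Eu Ex; do 2 case: (tau _ w).
- apply: contra01 => v; rewrite stpt.
  have [->|vx] := eqVneq v x; first by move: Ex; do 2 case: (tau _ x).
  have [->|vw] /= := eqVneq v w.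
    by move: par; rewrite Eu Ex; do 2 case: (tau _ w).
  rewrite addbF; have [->|vu] := eqVneq v u; last exact: same.
  by move: Eu; do 2 case: (tau _ u).
- apply: contra00 => v.
  have [->|vx] := eqVneq v x; first by move: Ex; do 2 case: (tau _ x).
  have [->|vw] := eqVneq v w; first by move: par; rewrite Eu Ex; do 2 case: (tau _ w).
  have [->|vu] := eqVneq v u; last exact: same.
  by move: Eu; do 2 case: (tau _ u).
Qed.

(** * Dense windows of moves *)

Definition inner (U : {set V}) (t : nat) : bool :=
  [&& kept t, e1 t \in U & e2 t \in U].

Definition nb_inner (U : {set V}) (i j : nat) : nat :=
  \sum_(i <= t < j) inner U t.

Definition deg_inner (U : {set V}) (i j : nat) (x : V) : nat :=
  \sum_(i <= t < j) (inner U t && ((x == e1 t) || (x == e2 t))).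

Lemma nb_inner_le U i j : (nb_inner U i j <= j - i)%N.
Proof.
rewrite /nb_inner -[leqRHS]muln1 -sum_nat_const_nat.
by apply: leq_sum => t _; case: inner.
Qed.

Lemma nb_innerD1 U i j x :
  (nb_inner U i j <= nb_inner (U :\ x) i j + deg_inner U i j x)%N.
Proof.
rewrite /nb_inner /deg_inner -big_split; apply: leq_sum => t _ /=.
rewrite /inner !inE ![_ == x]eq_sym; case: (kept t) => //=.
by case: (x == e1 t); case: (x == e2 t); case: (e1 t \in U); case: (e2 t \in U).
Qed.

Lemma nb_inner_card1 (U : {set V}) i j : (j <= l)%N -> #|U| = 1%N -> nb_inner U i j = 0%N.
Proof.
move=> jl /eqP/cards1P[u ->]; rewrite /nb_inner big_nat big1 // => t /andP[_ tj].
rewrite /inner; case: and3P => // -[_ /set1P e1u /set1P e2u].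
by have := neq_ends (leq_trans tj jl); rewrite e1u e2u eqxx.
Qed.

Variables (Dg J : nat).
Hypothesis Dg_gt0 : (0 < Dg)%N.
Hypothesis J_gt0 : (0 < J)%N.
Variable A : nat.
Hypothesis A_def : A = (16 * Dg * J)%N.
Variable R : realFieldType.
Let theta (u : nat) : R := 16%:R^-1 + harmonic_sum R u / (16 * J)%:R.

(* Deleting a vertex of degree less than [Dg] lowers the edge density of a
   window by at most [Dg / (A * #|U|)], the harmonic decrement of [theta]. *)
Lemma exists_dense_window (U : {set V}) i j : (i <= j <= l)%N -> (0 < #|U|)%N ->
  (A * #|U| <= nb_inner U i j)%N ->
  theta #|U| * (j - i)%:R <= (nb_inner U i j)%:R ->
  exists (U' : {set V}) i' j', [/\ (i' < j' <= l)%N, (1 < #|U'|)%N, U' \subset U,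
    (forall x, x \in U' -> (Dg <= deg_inner U' i' j' x)%N) &
    (j' - i' <= 32 * A * #|U'|)%N].
Proof.
(* Each step of the induction deletes a vertex or shortens the window. *)
move: {2}(#|U| + (j - i))%N (leqnn (#|U| + (j - i))) => m.
elim: m U i j => [|m IHm] U i j.
  by rewrite leqn0 addn_eq0 => /andP[/eqP -> _].
move=> le_m /andP[ij jl] U0 AU thU.
have A0 : (0 < A)%N by rewrite A_def !muln_gt0 Dg_gt0 J_gt0.
have leAb : (A * #|U| <= j - i)%N by apply: leq_trans AU (nb_inner_le _ _ _).
have U1 : (1 < #|U|)%N.
  rewrite ltn_neqAle U0 andbT; apply/eqP => /esym U1.
  by move: AU; rewrite nb_inner_card1 // U1 muln1 leqNgt A0.
case: (boolP [forall x in U, Dg <= deg_inner U i j x]%N); last first.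
  rewrite negb_forall => /existsP[x]; rewrite negb_imply -ltnNge => /andP[xU degx].
  have cU : #|U| = #|U :\ x|.+1 by rewrite (cardsD1 x) xU.
  have le1 := nb_innerD1 U i j x.
  have [|||||U' [i' [j' [h1 h2 h3 h4 h5]]]] := IHm (U :\ x) i j.
  - by move: le_m; rewrite cU; lia.
  - by rewrite ij.
  - by move: U1; rewrite cU.
  - move: AU; rewrite cU mulnS; have : (Dg <= A)%N.
      by rewrite A_def -mulnA [(Dg * _)%N]mulnC mulnA leq_pmull // muln_gt0.
    by move: le1 degx; lia.
  - have le2 : (nb_inner U i j)%:R - Dg%:R <= (nb_inner (U :\ x) i j)%:R :> R.
      by rewrite lerBlDr -natrD ler_nat; move: le1 degx; lia.
    apply: le_trans le2; rewrite lerBrDr; apply: le_trans thU.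
    rewrite /theta cU harmonic_sumS.
    have gen (a h b c e : R) : (a + (h + c) / e) * b = (a + h / e) * b + b * (c / e).
      by rewrite [(h + c) / e]mulrDl addrA [RHS]addrC mulrDl [LHS]addrC [b * _]mulrC.
    rewrite gen lerD2l -invfM -natrM.
    rewrite ler_pdivlMr ?ltr0n ?muln_gt0 ?J_gt0 // -natrM ler_nat.
    by move: leAb; rewrite cU A_def; lia.
  - exists U', i', j'; split=> //; exact: subset_trans h3 (subD1set _ _).
move/forall_inP => degU.
(* Fewer than [2 * (A * #|U|)] inner moves at density at least one sixteenth give the length bound
   [32 * A * #|U|]. *)
have [small|large] := ltnP (nb_inner U i j) (2 * (A * #|U|)).
  exists U, i, j; split=> //.
  - rewrite jl andbT; have : (0 < A * #|U|)%N by rewrite muln_gt0 A0.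
    by move: leAb; lia.
  - have : 16%:R^-1 * (j - i)%:R <= (nb_inner U i j)%:R :> R.
      apply: le_trans thU; rewrite ler_wpM2r // /theta lerDl.
      by rewrite divr_ge0 // harmonic_sum_ge0.
    rewrite ler_pdivrMl // -natrM ler_nat; move: small; lia.
(* Cut at the first time with [A * #|U|] inner moves. Both parts have at least that many, and if
   both were below the threshold density, so would be the whole window. *)
have [k [ik kj nbk]] : exists k, [/\ (i < k)%N, (k < j)%N & nb_inner U i k = (A * #|U|)%N].
  have AU0 : (0 < A * #|U|)%N by rewrite muln_gt0 A0.
  have ex : exists k, (A * #|U| <= nb_inner U i k)%N by exists j.
  case: (ex_minnP ex) => k AUk mink; exists k.
  have kj := mink _ AU.
  have ik : (i < k)%N.
    rewrite ltnNge; apply/negP => ki; move: AUk.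
    by rewrite /nb_inner big_geq // leqNgt AU0.
  have nbk : nb_inner U i k = (A * #|U|)%N.
    apply/eqP; rewrite eqn_leq AUk andbT leqNgt; apply/negP => ltk.
    have : (A * #|U| <= nb_inner U i k.-1)%N.
      move: ltk; rewrite /nb_inner -{1}(prednK (leq_ltn_trans (leq0n _) ik)).
      rewrite big_nat_recr /=; last by rewrite -ltnS prednK // (leq_ltn_trans _ ik).
      by case: inner; rewrite ?addn1 ?addn0 ?ltnS // => /ltnW.
    by move/mink; move: ik; lia.
  split=> //; rewrite ltn_neqAle kj andbT; apply/eqP => kj'.
  by move: large; rewrite -kj' nbk; lia.
have nbD : nb_inner U i j = (nb_inner U i k + nb_inner U k j)%N.
  by rewrite /nb_inner (big_cat_nat (n := k)) // ltnW.
have le_kj : (A * #|U| <= nb_inner U k j)%N by move: large; rewrite nbD nbk; lia.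
have [th1|th1] := leP (theta #|U| * (k - i)%:R) (nb_inner U i k)%:R.
  apply: (IHm U i k) => //.
  - by move: le_m ik kj; lia.
  - by rewrite (ltnW ik) (leq_trans (ltnW kj)).
  - by rewrite nbk.
apply: (IHm U k j) => //.
- by move: le_m ik kj; lia.
- by rewrite (ltnW kj).
- move: thU; rewrite nbD natrD (_ : j - i = (k - i) + (j - k))%N; last by lia.
  by rewrite natrD mulrDr => h; rewrite leNgt; apply/negP => h'; move: (ltrD th1 h'); rewrite ltNge h.
Qed.

(** * Circulations of moves and their certificates *)

Definition delta (t : nat) (v : V) : int := (tau t.+1 v)%:R - (tau t v)%:R.

Definition gauge (v : V) : int := (-1) ^+ eps v.

(** In the gauge a kept move raises one end and lowers the other; multiplied by its sign at [x] it
    becomes the oriented edge from [u] to [x]. *)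
Lemma gauge_delta t u x v : (t < l)%N -> kept t -> edge_at t u x ->
  gauge x * delta t x * (gauge v * delta t v) = (v == x)%:R - (v == u)%:R.
Proof.
move=> tl kt et; have ux := edge_at_neq tl et; have := kept_swap kt et.
rewrite /gauge /delta !(step_edge _ tl et) eqxx orbT.
have [->|vu] := eqVneq v u.
  rewrite (negPf ux) /=.
  by case: (tau t u); case: (tau t x); case: (eps u); case: (eps x).
have [->|vx] := eqVneq v x.
  by case: (tau t x); case: (eps x).
by rewrite /= addbF subrr mulr0 mulr0 subrr.
Qed.

Lemma gauge_sqr v : gauge v * gauge v = 1.
Proof. by rewrite /gauge; case: (eps v). Qed.

Definition circulation (i j K L : nat) (a : nat -> int) (W : {set V}) : Prop :=
  [/\ (#|W| <= L)%N,
      forall t, a t != 0 -> [&& (i <= t < j)%N, e1 t \in W & e2 t \in W],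
      forall t, `|a t| <= K%:R &
      forall v, \sum_(i <= t < j) a t * delta t v = 0].

(** For a [y] that the circulation leaves fixed, this sum is the coefficient of the interaction of
    [x] and [y], see [pairing_notin]. *)
Definition certifies (i j : nat) (a : nat -> int) (x y : V) : Prop :=
  \sum_(i <= t < j) a t * delta t x * (tau t y)%:R != 0.

Definition good (i j K L : nat) (x : V) : Prop :=
  exists (a : nat -> int) (W : {set V}) (y : V),
    [/\ x != z0, y != z0, y \notin W, circulation i j K L a W & certifies i j a x y].

Section Arm.
Variables (i j s t : nat) (a x b y : V).
Hypothesis jl : (j <= l)%N.
Hypothesis ijs : (i <= s < j)%N.
Hypothesis ijt : (i <= t < j)%N.
Hypothesis neq_st : s != t.
Hypothesis kept_s : kept s.
Hypothesis kept_t : kept t.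
Hypothesis edge_s : edge_at s a x.
Hypothesis edge_t : edge_at t x b.

(* The signs are such that, in the gauge [eps], the two moves together transfer
   one unit from [a] to [b] and none to [x]. *)
Definition arm (r : nat) : int :=
  gauge x * ((r == s)%:R * delta s x - (r == t)%:R * delta t x).

Let sl : (s < l)%N. Proof. by case/andP: ijs => _ /leq_trans; apply. Qed.
Let tl : (t < l)%N. Proof. by case/andP: ijt => _ /leq_trans; apply. Qed.

Lemma sum_arm (f : nat -> int) :
  \sum_(i <= r < j) arm r * f r =
  gauge x * (delta s x * f s - delta t x * f t).
Proof.
have pick1 (s0 : nat) (h : nat -> int) : (i <= s0 < j)%N ->
    \sum_(i <= r < j) (r == s0)%:R * h r = h s0.
  move=> hs0; rewrite (bigD1_seq s0) ?mem_index_iota ?iota_uniq //= eqxx mul1r.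
  by rewrite big1 ?addr0 // => r /negPf ->; rewrite mul0r.
transitivity (gauge x * (\sum_(i <= r < j) (r == s)%:R * (delta s x * f r) -
    \sum_(i <= r < j) (r == t)%:R * (delta t x * f r))).
  by rewrite -sumrB mulr_sumr; apply: eq_bigr => r _; rewrite /arm; ring.
by rewrite !pick1.
Qed.

Lemma arm_boundary v :
  \sum_(i <= r < j) arm r * delta r v = gauge v * ((b == v)%:R - (a == v)%:R).
Proof.
rewrite sum_arm.
transitivity (gauge v * (gauge x * delta s x * (gauge v * delta s v) -
    gauge x * delta t x * (gauge v * delta t v))).
  transitivity (gauge v * gauge v * (gauge x * (delta s x * delta s v - delta t x * delta t v))).
    by rewrite gauge_sqr mul1r.
  by ring.
rewrite (gauge_delta _ sl kept_s edge_s).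
rewrite (@gauge_delta t b x v tl kept_t); last by rewrite edge_atC.
by rewrite ![_ == v]eq_sym; congr (_ * _); ring.
Qed.

Lemma arm_le1 r : `|arm r| <= 1.
Proof.
have dl r' : `|delta r' x| <= 1.
  by rewrite /delta; case: (tau r'.+1 x); case: (tau r' x).
have g1 : `|gauge x| = 1 by rewrite /gauge; case: (eps x).
rewrite /arm normrM g1 mul1r.
case: eqP => [->|_]; first by rewrite (negPf neq_st) mul1r mul0r subr0.
by rewrite mul0r sub0r normrN; case: eqP => _; rewrite ?mul1r ?mul0r ?normr0.
Qed.

(** The square of [delta] at [x] is one for both moves, so up to sign the sum is the difference of
    [tau s y] and [tau t y]. *)
Lemma arm_certificate : tau s y != tau t y ->
  \sum_(i <= r < j) arm r * (delta r x * (tau r y)%:R) != 0.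
Proof.
move=> neq; rewrite sum_arm.
have -> : gauge x * (delta s x * (delta s x * (tau s y)%:R) -
   delta t x * (delta t x * (tau t y)%:R)) =
   gauge x * ((delta s x * delta s x) * (tau s y)%:R - (delta t x * delta t x) * (tau t y)%:R).
  by ring.
have sq r u : (r < l)%N -> edge_at r u x -> delta r x * delta r x = 1.
  move=> rl er; rewrite /delta (step_edge _ rl er) eqxx orbT.
  by case: (tau r x).
rewrite (sq s a) // (sq t b) //; last by rewrite edge_atC.
by move: neq; rewrite /gauge; case: (eps x); case: (tau s y); case: (tau t y).
Qed.

Lemma arm_support r : arm r != 0 -> r = s \/ r = t.
Proof.
rewrite /arm; have [->|_] := eqVneq r s; first by left.
have [->|_] := eqVneq r t; first by right.
by rewrite !mul0r subr0 mulr0 eqxx.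
Qed.

Lemma arm_delta_eq0 v r : v != x -> v != a -> v != b -> arm r * delta r v = 0.
Proof.
move=> vx va vb; case: (eqVneq (arm r) 0) => [->|]; first by rewrite mul0r.
move/arm_support => [] ->.
  by rewrite /delta (step_edge _ sl edge_s) (negPf va) (negPf vx) addbF subrr mulr0.
by rewrite /delta (step_edge _ tl edge_t) (negPf vb) (negPf vx) addbF subrr mulr0.
Qed.

End Arm.

Section Good.
Variables (i j : nat) (U : {set V}).
Hypothesis jl : (j <= l)%N.
Let K := (2 * J + 1)%N.
Let L := (3 * (2 * J + 1))%N.

Definition adjacent (x v : V) : bool :=
  has (fun t => inner U t && edge_at t x v) (index_iota i j).

Lemma adjacentP x v :
  reflect (exists t, [/\ (i <= t < j)%N, inner U t & edge_at t x v]) (adjacent x v).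
Proof.
apply: (iffP hasP) => [[t]|[t [h1 h2 h3]]].
  by rewrite mem_index_iota => h1 /andP[h2 h3]; exists t.
by exists t; rewrite ?mem_index_iota ?h2.
Qed.

Lemma edge_at_inner t u x : inner U t -> edge_at t u x -> (u \in U) && (x \in U).
Proof. by case/and3P=> _ h1 h2 /orP[] /andP[/eqP <- /eqP <-]; rewrite h1 h2. Qed.

Lemma edge_at_mem t u x (W : {set V}) : edge_at t u x -> u \in W -> x \in W ->
  (e1 t \in W) && (e2 t \in W).
Proof. by case/orP=> /andP[/eqP -> /eqP ->] -> ->. Qed.

(** When both outer ends are [v], the arm by itself has zero boundary. *)
Lemma parallel_good s t x v : x != z0 -> s != t -> (i <= s < j)%N -> (i <= t < j)%N ->
  inner U s -> inner U t -> edge_at s v x -> edge_at t v x -> good i j K L x.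
Proof.
move=> x0 st hs ht ins int es; rewrite edge_atC => et.
have [ks kt] : kept s /\ kept t by case/and3P: ins; case/and3P: int.
have sl : (s < l)%N by case/andP: hs => _ /leq_trans; apply.
have tl : (t < l)%N by case/andP: ht => _ /leq_trans; apply.
have [y [yv yx _ y0 neq]] := kept_witness sl tl st ks kt es et.
exists (arm s t x), [set v; x], y; split=> //.
- by rewrite !inE negb_or yv.
- split.
  + by rewrite cards2 /L; case: (v != x); clear; lia.
  + move=> r /arm_support [] ->; first by rewrite hs (edge_at_mem es) ?inE ?eqxx ?orbT.
    by rewrite ht (edge_at_mem et) ?inE ?eqxx ?orbT.
  + by move=> r; rewrite (le_trans (arm_le1 _ _ _)) // ler1n /K addn1.
  + by move=> u; rewrite (arm_boundary jl hs ht ks kt es et) subrr mulr0.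
- rewrite /certifies; under eq_bigr do rewrite -mulrA.
  exact: (arm_certificate jl hs ht es et).
Qed.

(** By [parallel_good], different inner moves at [x] lead to different neighbours. *)
Lemma not_good_degree x : x != z0 -> ~ good i j K L x ->
  (deg_inner U i j x <= #|[set v | adjacent x v]|)%N.
Proof.
move=> x0 ngood.
set ts := [seq t <- index_iota i j | inner U t && ((x == e1 t) || (x == e2 t))].
pose o t := if x == e1 t then e2 t else e1 t.
have ots t : t \in ts -> [/\ (i <= t < j)%N, inner U t & edge_at t x (o t)].
  rewrite mem_filter mem_index_iota => /andP[/andP[h1 h2] h3]; split=> //.
  rewrite /edge_at /o; case: (eqVneq x (e1 t)) h2 => [-> _|_ /=].
    by rewrite !eqxx.
  by move/eqP <-; rewrite !eqxx ?orbT.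
have -> : deg_inner U i j x = size (map o ts).
  rewrite size_map size_filter -sum1_count [RHS]big_mkcond.
  by apply: eq_bigr => t _; case: (_ && _).
have uniq_ots : uniq (map o ts).
  rewrite map_inj_in_uniq ?filter_uniq ?iota_uniq // => s t /ots[h1 h2 h3] /ots[h4 h5 h6] ost.
  apply/eqP/negPn/negP => st; apply: ngood.
  apply: (@parallel_good s t x (o s)) => //; first by rewrite edge_atC.
  by rewrite edge_atC ost.
rewrite -(card_uniqP uniq_ots); apply/subset_leq_card/subsetP => v /mapP[t tts ->].
by rewrite inE; apply/adjacentP; exists t; apply/ots.
Qed.

(* Otherwise most vertices are not good, so by [exists_hubs] they have two distinct
   neighbours in a small set of hubs; their arms are then edges of a dense
   multigraph on the hubs, and a short circulation through the arm of [x] makes [x]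
   good provided that the witness of [x] lies on no arm, which a colouring ensures. *)
Lemma many_good : (1 < #|U|)%N -> (forall x, x \in U -> (401 <= deg_inner U i j x)%N) ->
  (#|V| < 2 ^ J)%N ->
  (#|U| <= 8 * #|[set x in U | `[< good i j K L x >]]|)%N.
Proof.
move=> U1 degU VJ; set X := finset _; rewrite leqNgt; apply/negP => X8.
pose T := (U :\: X) :\ z0.
have TP x : x \in T -> [/\ x \in U, x != z0 & ~ good i j K L x].
  by rewrite !inE => /and3P[x0]; case: (x \in U) => //= /asboolPn.
have TU : T \subset U by apply/subsetP => x /TP[].
have cT : (#|U| <= #|T| + #|X| + 1)%N.
  have := cardsID X U; rewrite (setIidPr _); last by apply/subsetP => x; rewrite inE => /andP[].
  have := cardsD1 z0 (U :\: X); rewrite -/T; case: (z0 \in _) => /=;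
    by move: #|_| #|_| #|_| #|_|; clear; lia.
have nbP x : x \in T -> [set v | adjacent x v] \subset U /\ (400 < #|[set v | adjacent x v]|)%N.
  move=> /TP[xU x0 ngood]; split.
    apply/subsetP => v; rewrite inE => /adjacentP[t [_ int /(edge_at_inner int)]].
    by case/andP.
  exact: leq_trans (degU _ xU) (not_good_degree x0 ngood).
(* There are at most [#|U| / 50] hubs, and at most [#|U| / 4] vertices of [T] have fewer than two
   neighbours among them; thus [T'] keeps half of [U]. *)
have [Hb [HU cH cN]] := exists_hubs 100 TU nbP.
set N := finset _ in cN.
have cTU := subset_leq_card TU.
have cU : (400 < #|U|)%N.
  have /card_gt0P[x xT] : (0 < #|T|)%N by move: cT X8 U1; move: #|_| #|_| #|_|; clear; lia.
  by have [sub h] := nbP _ xT; apply: leq_trans h (subset_leq_card sub).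
pose T' := (T :\: N) :\: Hb.
have cT' : (#|U| <= 2 * #|T'|)%N.
  have h1 := cardsID N T; have h2 := cardsID Hb (T :\: N).
  have h3 := subset_leq_card (subsetIr T N); have h4 := subset_leq_card (subsetIr (T :\: N) Hb).
  rewrite -/T' in h2.
  move: h1 h2 h3 h4 cH cN cT X8 cTU cU.
  move: #|T'| #|T :&: N| #|(T :\: N) :&: Hb| #|T :\: N| #|N| #|Hb| #|X| #|T| #|U|.
  by clear; lia.
pose armspec x (q : nat * nat * (V * V * V)) :=
  let: (s, t, (a, b, y)) := q in
  [/\ [/\ (i <= s < j)%N, (i <= t < j)%N & s != t], [/\ inner U s, inner U t, edge_at s a x & edge_at t x b],
      [/\ a \in Hb, b \in Hb & a != b] & [/\ y != a, y != x, y != b, y != z0 & tau s y != tau t y]].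
have /fin_all_exists [q hq] x : exists q, x \in T' -> armspec x q.
  case: (boolP (x \in T')) => [xT'|_]; last by exists (0%N, 0%N, (x, x, x)).
  move: (xT'); rewrite inE => /andP[_]; rewrite inE => /andP[].
  rewrite inE => + xT; rewrite xT /= -ltnNge => h2.
  have /card_gt1P[a [b [+ + ab]]] := h2.
  rewrite !inE => /andP[/adjacentP[s [hs ins es]] aH] /andP[/adjacentP[t [ht int et]] bH].
  rewrite edge_atC in es.
  have sl : (s < l)%N by case/andP: hs => _ /leq_trans; apply.
  have tl : (t < l)%N by case/andP: ht => _ /leq_trans; apply.
  have st : s != t.
    apply/eqP => st; subst t; move: ab; apply/negP; rewrite negbK.
    have xa := edge_at_neq sl es; have xb := edge_at_neq sl et.
    move: es et xa xb => /orP[] /andP[/eqP <- /eqP <-] /orP[] /andP[/eqP h /eqP h'];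
      by rewrite ?h ?h' ?eqxx // -?h -?h' ?eqxx.
  have [ks kt] : kept s /\ kept t by case/and3P: ins; case/and3P: int.
  have [y [ya yx yb y0 neq]] := kept_witness sl tl st ks kt es et.
  by exists (s, t, (a, b, y)).
pose sx x := (q x).1.1; pose tx x := (q x).1.2.
pose ax x := (q x).2.1.1; pose bx x := (q x).2.1.2; pose yx x := (q x).2.2.
have {}hq x : x \in T' -> [/\ [/\ (i <= sx x < j)%N, (i <= tx x < j)%N & sx x != tx x],
   [/\ inner U (sx x), inner U (tx x), edge_at (sx x) (ax x) x & edge_at (tx x) x (bx x)],
   [/\ ax x \in Hb, bx x \in Hb & ax x != bx x] &
   [/\ yx x != ax x, yx x != x, yx x != bx x, yx x != z0 & tau (sx x) (yx x) != tau (tx x) (yx x)]].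
  by move/hq; rewrite /sx /tx /ax /bx /yx; case: (q x) => [[? ?] [[? ?] ?]].
(* Six colours against three pairs spoil at most half of [T']; some colour [k] of witnesses then
   keeps [#|T'| / 12] arms, at least twice the number of hubs. *)
have [|e eT'|c] := @exists_coloring V V 'I_6 T' (fun x => [:: (yx x, ax x); (yx x, x); (yx x, bx x)]) 3.
- by rewrite card_ord.
- by have [_ _ _ [h1 h2 h3 _ _]] := hq _ eT'; rewrite /= h1 h2 h3.
rewrite card_ord; set Bad := finset _ => cBad.
pose Ik (k : 'I_6) := [set x in T' :\: Bad | c (yx x) == k].
have [k cIk] : exists k, (#|T'| <= 12 * #|Ik k|)%N.
  have : (\sum_(k < 6) #|Ik k| = #|T' :\: Bad|)%N.
    rewrite -[RHS]sum1_card (partition_big (fun x => c (yx x)) predT) //=.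
    apply: eq_bigr => k _; rewrite -sum1_card; apply: eq_bigl => x; by rewrite inE.
  have := cardsID Bad T'; rewrite (setIidPr _); last by apply/subsetP => x; rewrite inE => /andP[].
  move=> h1 h2.
  case: (boolP [exists k, #|T'| <= 12 * #|Ik k|]%N) => [/existsP//|].
  rewrite negb_exists => /forallP small.
  have [T'0|T'0] := posnP #|T'|; first by exists ord0; rewrite T'0.
  have : (12 * \sum_(k < 6) #|Ik k| <= \sum_(k < 6) #|T'|.-1)%N.
    rewrite big_distrr; apply: leq_sum => k _.
    by have := small k; rewrite -ltnNge; case: #|T'|.
  rewrite sum_nat_const card_ord h2; move: cBad h1 T'0.
  by move: #|_| #|_| #|_|; clear; lia.
pose I := Ik k.
have IT' x : x \in I -> x \in T' by rewrite !inE => /andP[/andP[_ ->]].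
have [|||| p [[e eI pe] psupp pnorm pb]] := @exists_short_circulation V V ax bx I Hb J.
- by move=> x /IT' /hq[_ _ [_ _]].
- by move=> x /IT' /hq[_ _ [-> ->]].
- apply/andP; split.
    have /card_gt0P[x xT'] : (0 < #|T'|)%N by move: cT' cU; move: #|_| #|_|; clear; lia.
    by apply/card_gt0P; exists (ax x); have [_ _ [->]] := hq _ xT'.
  by apply: leq_ltn_trans VJ; apply: max_card.
- move: cIk cT' cH cTU; rewrite -/I; move: #|T'| #|I| #|Hb| #|T| #|U|; clear; lia.
have eT' := IT' _ eI.
(* The arm of [f] moves only [f] and two hubs, so the certificate at [e] sees no arm but that of
   [e]. *)
have eHb : e \notin Hb by move: eT'; rewrite inE => /andP[].
have eT : e \in T by move: eT'; rewrite !inE => /andP[_ /andP[_]].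
have [eU e0 ngood] := TP _ eT; apply: ngood.
pose arms f := arm (sx f) (tx f) f.
pose a t := \sum_f p f * arms f t.
pose S := [set f | p f != 0].
have SI f : f \in S -> f \in I.
  by rewrite inE; apply: contraNT => fI; rewrite psupp.
have asum (h : nat -> int) : \sum_(i <= t < j) a t * h t =
    \sum_(f in S) p f * \sum_(i <= t < j) arms f t * h t.
  rewrite /a; under eq_bigr do rewrite mulr_suml.
  rewrite exchange_big /= [LHS](bigID (mem S)) /= [X in _ + X]big1 ?addr0; last first.
    by move=> f; rewrite inE negbK => /eqP ->; rewrite big1 // => t _; rewrite !mul0r.
  by apply: eq_bigr => f _; rewrite mulr_sumr; apply: eq_bigr => t _; rewrite mulrA.
have colorS f v : f \in S -> v \in [:: f; ax f; bx f] -> c v != k.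
  move=> /SI; rewrite 2!inE => /andP[/andP[+ fT']] /eqP ck.
  rewrite inE fT' /= !negb_or ck => /and4P[h1 h2 h3 _].
  by rewrite !inE => /or3P[] /eqP ->; rewrite eq_sym.
(* No vertex of this support has the colour [k] of [yx e]. *)
exists a, (S :|: ax @: S :|: bx @: S), (yx e).
have [_ _ _ [ya ye yb y0 neqy]] := hq _ eT'.
split=> //.
- have ck : c (yx e) = k by move: eI; rewrite inE => /andP[_ /eqP].
  apply/negP; rewrite !inE -orbA => /or3P[yS|/imsetP[f fS yE]|/imsetP[f fS yE]].
  + have : yx e \in S by rewrite inE.
    by move/colorS => /(_ (yx e)); rewrite mem_head ck eqxx => /(_ isT).
  + by have := colorS f (ax f) fS; rewrite !inE eqxx orbT -yE ck eqxx => /(_ isT).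
  + by have := colorS f (bx f) fS; rewrite !inE eqxx !orbT -yE ck eqxx => /(_ isT).
- split.
  + have cS : (#|S| <= 2 * J + 1)%N.
      rewrite -(ler_nat int); apply: le_trans pnorm.
      rewrite -sum1_card natr_sum [leLHS]big_mkcond; apply: ler_sum => f _.
      by rewrite inE; case: (eqVneq (p f) 0) => [->|]; rewrite ?normr0 // -normr_gt0 gtz0_ge1.
    have h1 : (#|ax @: S| <= #|S|)%N := leq_imset_card ax (mem S).
    have h2 : (#|bx @: S| <= #|S|)%N := leq_imset_card bx (mem S).
    have h3 := (leq_card_setU (S :|: ax @: S) (bx @: S)).1.
    have h4 := (leq_card_setU S (ax @: S)).1.
    rewrite /L; move: cS h1 h2 h3 h4.
    move: #|S :|: ax @: S :|: bx @: S| #|S :|: ax @: S| #|ax @: S| #|bx @: S| #|S|.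
    by clear; lia.
  + move=> t at0.
    have [f fS ft] : exists2 f, f \in S & arms f t != 0.
      case: (boolP [exists f, (f \in S) && (arms f t != 0)]).
        by case/existsP=> f /andP[]; exists f.
      rewrite negb_exists => /forallP none; move: at0; rewrite /a big1 ?eqxx // => f _.
      have := none f; rewrite inE negb_and !negbK.
      by case/orP=> /eqP ->; rewrite ?mul0r ?mulr0.
    have [[h1 h2 _] [_ _ h4 h5] _ _] := hq _ (IT' _ (SI _ fS)).
    have fW : f \in S :|: ax @: S :|: bx @: S by rewrite !in_setU fS.
    have aW : ax f \in S :|: ax @: S :|: bx @: S by rewrite !in_setU imset_f ?orbT.
    have bW : bx f \in S :|: ax @: S :|: bx @: S by rewrite !in_setU imset_f ?orbT.
    case: (arm_support ft) => ->; first by rewrite h1 (edge_at_mem h4).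
    by rewrite h2 (edge_at_mem h5).
  + move=> t; rewrite (le_trans (ler_norm_sum _ _ _)) // (le_trans _ pnorm) //.
    apply: ler_sum => f _; have [->|pf] := eqVneq (p f) 0.
      by rewrite mul0r normr0.
    rewrite normrM ler_piMr //.
    have fS : f \in S by rewrite inE.
    by have [[_ _ h1] _ _ _] := hq _ (IT' _ (SI _ fS)); apply: arm_le1.
  + move=> v; rewrite asum.
    transitivity (gauge v * \sum_f p f * ((bx f == v)%:R - (ax f == v)%:R)); last first.
      by have := pb v; rewrite /boundary => ->; rewrite mulr0.
    rewrite mulr_sumr [RHS](bigID (mem S)) /= [X in _ = _ + X]big1 ?addr0; last first.
      by move=> f; rewrite inE negbK => /eqP ->; rewrite mul0r mulr0.
    apply: eq_bigr => f fS.
    have [[h1 h2 h3] [h4 h5 h6 h7] _ _] := hq _ (IT' _ (SI _ fS)).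
    have [ks kt] : kept (sx f) /\ kept (tx f) by case/and3P: h4; case/and3P: h5.
    by rewrite /arms (arm_boundary jl h1 h2 ks kt h6 h7) mulrCA.
- rewrite /certifies; under eq_bigr do rewrite -mulrA.
  rewrite asum (bigD1 e) /=; last by rewrite inE.
  rewrite [X in _ + X]big1 ?addr0 => [|f /andP[fS fe]].
    have [[h1 h2 h3] [h4 h5 h6 h7] _ _] := hq _ eT'.
    by rewrite mulf_neq0 // (arm_certificate jl h1 h2 h6 h7).
  have [[h1 h2 h3] [h4 h5 h6 h7] [h8 h9 _] _] := hq _ (IT' _ (SI _ fS)).
  rewrite big1 ?mulr0 // => t _; rewrite mulrA (arm_delta_eq0 jl h1 h2 h6 h7) ?mul0r //.
  + by rewrite eq_sym.
  + by apply: contraNneq eHb => ->.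
  + by apply: contraNneq eHb => ->.
Qed.

End Good.

End Walk.

(** * Choice of the gauge *)

Section Gauge.
Variables (V : finType) (z0 : V) (tau : nat -> V -> bool) (e1 e2 : nat -> V).
Variable l : nat.
Hypothesis neq_ends : forall t, (t < l)%N -> e1 t != e2 t.

Lemma half_even : (l <= 2 * \sum_(0 <= t < l) ~~ odd t)%N.
Proof.
clear; suff : (l + odd l <= 2 * \sum_(0 <= t < l) ~~ odd t)%N by lia.
elim: l => [|m IHm]; first by rewrite big_geq.
by rewrite big_nat_recr //= mulnDr; move: IHm; case: (odd m) => /=; lia.
Qed.

(** Three halvings: the even times, a value of [z0] taken at half of them, and a random gauge, in
    which the ends of a move differ with probability one half. *)
Lemma exists_gauge : exists (eps : {ffun V -> bool}) (g : bool),
  (l <= 8 * \sum_(0 <= t < l) kept z0 tau e1 e2 eps g t)%N.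
Proof.
pose P g t := ~~ odd t && (tau t z0 == g).
have [g hg] : exists g, (l <= 4 * \sum_(0 <= t < l) P g t)%N.
  have : (\sum_(0 <= t < l) ~~ odd t = \sum_(0 <= t < l) P true t + \sum_(0 <= t < l) P false t)%N.
    rewrite -big_split; apply: eq_bigr => t _.
    by rewrite /P; case: (odd t); case: (tau t z0).
  have := half_even.
  have [|] := leqP l (4 * \sum_(0 <= t < l) P true t); first by exists true.
  by move=> ? ? ?; exists false; lia.
pose Q (eps : {ffun V -> bool}) t :=
  tau t (e1 t) (+) eps (e1 t) == tau t (e2 t) (+) eps (e2 t).
have [||eps heps] := @exists_le_average {ffun V -> bool}
   (fun eps => 2 * \sum_(0 <= t < l) (P g t && Q eps t))%N (\sum_(0 <= t < l) P g t)%N.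
- by rewrite card_ffun expn_gt0 card_bool.
- rewrite -big_distrr exchange_big /= !big_distrr /= big_nat_cond [leqRHS]big_nat_cond.
  apply: leq_sum => t /andP[/andP[_ tl] _].
  have := @card_constrained_coloring V bool
    (fun b => tau t (e1 t) (+) tau t (e2 t) (+) b) _ _ (neq_ends tl).
  rewrite card_bool => <-; rewrite -sum1_card [X in (_ <= X * _ * _)%N]big_mkcond /=.
  rewrite [X in (_ <= X * _)%N]mulnC -mulnA leq_mul2l /= big_distrl /=.
  apply: leq_sum => eps _.
  rewrite inE /Q; case: (P g t) => //=; case: (tau t (e1 t)); case: (tau t (e2 t)) => /=;
  by case: (eps (e1 t)); case: (eps (e2 t)).
exists eps, g.
have : (\sum_(0 <= t < l) P g t = \sum_(0 <= t < l) (P g t && Q eps t) +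
   \sum_(0 <= t < l) kept z0 tau e1 e2 eps g t)%N.
  rewrite -big_split; apply: eq_bigr => t _; rewrite /kept /P /Q /=.
  by case: odd; case: (tau t z0 == g); case: (_ (+) _ == _).
move: hg heps; move: (\sum_(_ <= _ < _) _)%N (\sum_(_ <= _ < _) _)%N (\sum_(_ <= _ < _) _)%N.
by clear; lia.
Qed.

End Gauge.

(** * Windows with many independent certificates *)

Section Rich.
Variables (V : finType) (z0 : V) (tau : nat -> V -> bool) (e1 e2 : nat -> V).
Variable l : nat.
Hypothesis neq_ends : forall t, (t < l)%N -> e1 t != e2 t.
Hypothesis step : forall t v, (t < l)%N ->
  tau t.+1 v = tau t v (+) ((v == e1 t) || (v == e2 t)).
Hypothesis tau_inj : forall s t, (s <= l)%N -> (t <= l)%N ->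
  tau s =1 tau t -> s = t.

(** The bilinear part of a combined gain: by [pair_formP] a binary function on [x] and [y] enters
    only through this number. *)
Definition pairing (i j : nat) (a : nat -> int) (x y : V) : int :=
  \sum_(i <= t < j) a t *
    ((tau t.+1 x && tau t.+1 y)%:R - (tau t x && tau t y)%:R).

Lemma pairing_notin i j K L a (W : {set V}) x y : (j <= l)%N ->
  circulation tau e1 e2 i j K L a W -> y \notin W ->
  pairing i j a x y = \sum_(i <= t < j) a t * delta tau t x * (tau t y)%:R.
Proof.
move=> jl [_ supp _ _] yW; rewrite /pairing !big_nat; apply: eq_bigr => t /andP[_ tj].
have [->|at0] := eqVneq (a t) 0; first by rewrite !mul0r.
have /and3P[_ h1 h2] := supp _ at0.
have ty : tau t.+1 y = tau t y.
  rewrite step ?(leq_trans tj) //.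
  by case: eqP yW => [->|_]; rewrite ?h1 //; case: eqP => [->|_]; rewrite ?h2 // addbF.
rewrite /delta ty -mulrA; case: (tau t y); rewrite ?mulr1 ?andbT //.
by rewrite !andbF subrr !mulr0.
Qed.

Lemma pairing_notin2 i j K L a (W : {set V}) x y : (j <= l)%N ->
  circulation tau e1 e2 i j K L a W -> x \notin W -> y \notin W ->
  pairing i j a x y = 0.
Proof.
move=> jl circ xW yW; rewrite (pairing_notin _ jl circ yW) big_nat big1 // => t /andP[_ tj].
have [_ supp _ _] := circ.
have [->|at0] := eqVneq (a t) 0; first by rewrite !mul0r.
have /and3P[_ h1 h2] := supp _ at0.
rewrite /delta step ?(leq_trans tj) //.
case: eqP xW => [->|_]; rewrite ?h1 //; case: eqP => [->|_]; rewrite ?h2 // addbF.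
by rewrite subrr mulr0 mul0r.
Qed.

(* Give [x] and [y x] colours that no other vertex of the support of the
   circulation attached to [x] has; then keep one pair of colours. *)
Lemma independent_certificates i j K L (X : {set V}) :
  (j <= l)%N -> (0 < L)%N ->
  (forall x, x \in X -> good z0 tau e1 e2 i j K L x) ->
  exists (I : {set V}) (a : V -> nat -> int) (y : V -> V),
    [/\ (#|X| <= 32 * L ^ 2 * #|I|)%N,
      forall x, x \in I -> [/\ x \in X, x != z0 & y x != z0],
      forall x, x \in I -> [/\ forall t, a x t != 0 -> (i <= t < j)%N,
        forall t, `|a x t| <= K%:R & forall v, \sum_(i <= t < j) a x t * delta tau t v = 0] &
      forall x x', x \in I -> x' \in I -> (pairing i j (a x) x' (y x') != 0) = (x == x')].
Proof.
move=> jl L0 goodX.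
have /fin_all_exists [q hq] x : exists q : (nat -> int) * {set V} * V, x \in X ->
    [/\ x != z0, q.2 != z0, q.2 \notin q.1.2, circulation tau e1 e2 i j K L q.1.1 q.1.2
      & certifies tau i j q.1.1 x q.2].
  case: (boolP (x \in X)) => [/goodX[a [W [y h]]]|_]; first by exists (a, W, y).
  by exists (fun _ => 0, set0, x).
pose a x := (q x).1.1; pose W x := (q x).1.2; pose y x := (q x).2.
have {}hq x : x \in X -> [/\ x != z0, y x != z0, y x \notin W x,
    circulation tau e1 e2 i j K L (a x) (W x) & certifies tau i j (a x) x (y x)].
  exact: hq.
(* Twice the [2 * L] pairs to be separated, so at most half of [X] is spoiled; one of the [s ^ 2]
   pairs of colours then keeps a share of at least [1 / (32 * L ^ 2)]. *)
pose s := (4 * L)%N.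
have s0 : (0 < s)%N by rewrite muln_gt0.
pose ps x := [seq (x, w) | w <- enum (W x :\ x)] ++ [seq (y x, w) | w <- enum (W x)].
have [||c] := @exists_coloring V V 'I_s X ps (2 * L).
- by rewrite card_ord.
- move=> x xX; have [_ _ yW [cW _ _ _] _] := hq _ xX; split.
    rewrite size_cat !size_map -!cardE.
    have := subset_leq_card (subD1set (W x) x); move: cW.
    by move: #|_| #|_|; clear; lia.
  rewrite all_cat; apply/andP; split; apply/allP => p /mapP[w].
    by rewrite mem_enum !inE => /andP[wx _] ->; rewrite eq_sym.
  rewrite mem_enum => wW ->; apply: contraNneq yW => /= ->; exact: wW.
rewrite card_ord; set Bad := finset _ => cBad.
pose Ik (k : 'I_s * 'I_s) := [set x in X :\: Bad | (c x, c (y x)) == k].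
have [k cIk] : exists k, (#|X| <= 2 * s ^ 2 * #|Ik k|)%N.
  have : (\sum_k #|Ik k| = #|X :\: Bad|)%N.
    rewrite -[RHS]sum1_card (partition_big (fun x => (c x, c (y x))) predT) //=.
    apply: eq_bigr => k _; rewrite -sum1_card; apply: eq_bigl => x; by rewrite inE.
  have := cardsID Bad X; rewrite (setIidPr _); last by apply/subsetP => x; rewrite inE => /andP[].
  move=> h1 h2.
  case: (boolP [exists k, #|X| <= 2 * s ^ 2 * #|Ik k|]%N) => [/existsP//|].
  rewrite negb_exists => /forallP small.
  have [X0|X0] := posnP #|X|; first by exists (Ordinal s0, Ordinal s0); rewrite X0.
  have : (2 * s ^ 2 * \sum_k #|Ik k| <= \sum_(k : 'I_s * 'I_s) #|X|.-1)%N.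
    rewrite big_distrr; apply: leq_sum => k _.
    by have := small k; rewrite -ltnNge; case: #|X|.
  rewrite sum_nat_const card_prod card_ord h2 -mulnn => h3.
  have {h3} : (2 * #|X :\: Bad| <= #|X|.-1)%N.
    have ss0 : (0 < s * s)%N by rewrite muln_gt0 s0.
    rewrite -(leq_pmul2l ss0) (leq_trans _ h3) //.
    by rewrite mulnA [(s * s * 2)%N]mulnC.
  have cBad' : (2 * #|Bad| <= #|X|)%N.
    rewrite -(leq_pmul2l (_ : 0 < 2 * L)%N) ?muln_gt0 ?L0 // (leq_trans _ cBad) //.
    by apply/eq_leq; rewrite /s; move: #|Bad|; clear; lia.
  move: cBad' h1 X0; by move: #|_| #|_| #|_|; clear; lia.
pose I := Ik k.
have IX x : x \in I -> x \in X by rewrite !inE => /andP[/andP[_ ->]].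
(* All of [I] has the same pair of colours, while in [W x] only [x] may have the colour of [x], and
   nothing has that of [y x]. *)
have color x x' : x \in I -> x' \in I -> x != x' -> (x' \notin W x) && (y x' \notin W x).
  rewrite 2!inE => /andP[/andP[+ xX] /eqP ck]; rewrite inE xX /= => /hasPn nb.
  rewrite 2!inE => /andP[/andP[_ x'X] /eqP ck'] xx'.
  have [c1 c2] : c x = c x' /\ c (y x) = c (y x') by move: ck; rewrite -ck' => -[].
  apply/andP; split; apply/negP => wW.
    have := nb (x, x'); rewrite /= c1 eqxx mem_cat map_f ?mem_enum ?inE ?wW ?andbT 1?eq_sym //.
    by move/(_ isT).
  by have := nb (y x, y x'); rewrite /= c2 eqxx mem_cat orbC map_f ?mem_enum // => /(_ isT).
exists I, a, y; split.
- move: cIk; rewrite -/I /s expnMn => /leq_trans; apply.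
  by rewrite mulnA.
- by move=> x xI; have [h1 h2] := hq _ (IX _ xI); split=> //; apply: IX.
- move=> x xI; have [_ _ _ [_ h1 h2 h3] _] := hq _ (IX _ xI); split=> // t /h1.
  by case/and3P.
- move=> x x' xI x'I; have [xx'|xx'] := eqVneq x x'.
    subst x'; have [h1 h2 h3 h4 h5] := hq _ (IX _ xI).
    by rewrite (pairing_notin _ jl h4 h3).
  have [_ _ _ h4 _] := hq _ (IX _ xI).
  by have /andP[h1 h2] := color _ _ xI x'I xx'; rewrite (pairing_notin2 jl h4 h1 h2) eqxx.
Qed.

Lemma exists_rich_window J :
  (0 < J)%N -> (0 < #|V| < 2 ^ J)%N -> (8 * (16 * 401 * J) * #|V| <= l)%N ->
  exists i j (I : {set V}) (a : V -> nat -> int) (y : V -> V),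
    [/\ (i < j <= l)%N /\ (0 < #|I|)%N,
      (j - i <= 32 * (16 * 401 * J) * 8 * 32 * (3 * (2 * J + 1)) ^ 2 * #|I|)%N,
      forall x, x \in I -> (x != z0) && (y x != z0),
      forall x, x \in I -> [/\ forall t, a x t != 0 -> (i <= t < j)%N,
        forall t, `|a x t| <= (2 * J + 1)%:R &
        forall v, \sum_(i <= t < j) a x t * delta tau t v = 0] &
      forall x x', x \in I -> x' \in I -> (pairing i j (a x) x' (y x') != 0) = (x == x')].
Proof.
move=> J0 /andP[V0 VJ] hl.
have [eps [g hk]] := exists_gauge z0 tau neq_ends.
have nbE : nb_inner z0 tau e1 e2 eps g setT 0 l =
    (\sum_(0 <= t < l) kept z0 tau e1 e2 eps g t)%N.
  by apply: eq_bigr => t _; rewrite /inner !inE !andbT.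
have [||||U [i [j [/andP[ij jl] U1 _ degU jiU]]]] :=
  @exists_dense_window V z0 tau e1 e2 l neq_ends eps g 401 J isT J0 _ erefl rat setT 0 l.
- by rewrite leqnn.
- by rewrite cardsT.
- rewrite nbE cardsT; move: hl hk; set A := (16 * 401 * J)%N.
  by move: A (\sum_(_ <= _ < _) _)%N #|V|; clear; nia.
- rewrite cardsT subn0 nbE.
  apply: (@le_trans _ _ (8%:R^-1 * l%:R)).
    apply: ler_wpM2r; first exact: ler0n.
    exact: harmonic_sum_threshold.
  by rewrite ler_pdivrMl // -natrM ler_nat.
have mg := many_good neq_ends step tau_inj jl U1 degU VJ.
set X := finset _ in mg.
have [||I [a [y [h1 h2 h3 h4]]]] := @independent_certificates i j (2 * J + 1) (3 * (2 * J + 1)) X jl.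
- by rewrite muln_gt0 addn1.
- by move=> x; rewrite inE => /andP[_ /asboolP].
exists i, j, I, a, y; split=> //; last by move=> x /h2[_ -> ->].
- split; first by rewrite ij.
  rewrite lt0n; apply/eqP => I0; move: h1 mg U1; rewrite I0 muln0.
  by move: #|_| #|_|; clear; lia.
- apply: leq_trans jiU _.
  apply: leq_trans (leq_mul (leqnn _) (leq_trans mg (leq_mul (leqnn 8) h1))) _.
  by rewrite !mulnA.
Qed.

End Rich.

From mathcomp Require Import all_classical all_reals all_analysis.
From mathcomp Require Import measurable_realfun.

Import numFieldNormedType.Exports.

Local Open Scope classical_set_scope.
Local Open Scope ring_scope.

(** * Random weights *)

Section Prob.
Variables (R : realType) (disp : measure_display) (T : measurableType disp).
Variable P : probability T R.

Lemma measurable_finite_union (K : finType) (E : K -> set T) :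
  (forall k, measurable (E k)) -> measurable (\bigcup_k E k).
Proof. by move=> mE; apply: fin_bigcup_measurable => // k _; exact: mE. Qed.

Lemma union_bound (K : finType) (E : K -> set T) :
  (forall k, measurable (E k)) -> (P (\bigcup_k E k) <= \sum_k P (E k))%E.
Proof.
move=> mE.
have mU s : measurable (\bigcup_(k in [set` s]) E k).
  by apply: fin_bigcup_measurable => // k _; exact: mE.
have H s : (P (\bigcup_(k in [set` s]) E k) <= \sum_(k <- s) P (E k))%E.
  elim: s => [|k s IHs]; first by rewrite set_nil bigcup_set0 measure0 big_nil.
  have -> : \bigcup_(k' in [set` k :: s]) E k' = E k `|` \bigcup_(k' in [set` s]) E k'.
    apply/seteqP; split=> t.
      by case=> k' /=; rewrite inE => /orP[/eqP ->|ks] Et; [left | right; exists k'].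
    case=> [Et|[k' /= ks Et]]; first by exists k; rewrite //= mem_head.
    by exists k'; rewrite //= inE ks orbT.
  by rewrite big_cons (le_trans (measureU2 _ _ _)) // leeD2l.
have := H (enum K); rewrite big_enum /= => h; apply: le_trans h.
rewrite le_measure ?inE //; first exact: measurable_finite_union.
by move=> t [k _ Ek]; exists k => //=; rewrite mem_enum.
Qed.

Lemma interval_bound (X : {RV P >-> R}) (phi a b : R) :
  density_at_most X phi -> a <= b -> (P (X @^-1` `[a, b[) <= (phi * (b - a))%:E)%E.
Proof.
move=> [p [mp p0 pE] pphi] ab.
have := pE `[a, b[%classic (measurable_itv _); rewrite /distribution /pushforward => ->.
apply: (@le_trans _ _ (\int[lebesgue_measure]_(x in `[a, b[%classic) (cst phi%:E) x)%E).
  apply: ge0_le_integral => //.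
  - by move=> x _; rewrite lee_fin.
  - by apply/measurable_EFinP; apply: measurable_funS mp.
  - by move=> x _; rewrite lee_fin.
rewrite integral_cst //= lebesgue_measure_itv /= lte_fin.
case: ltP => [_|ba]; first by rewrite -EFinB -EFinM.
by rewrite mule0 lee_fin mulr_ge0 ?subr_ge0 // (le_trans (p0 0)).
Qed.

Lemma measurable_RV_itv (X : {RV P >-> R}) (i : interval R) :
  measurable (X @^-1` [set` i]).
Proof. exact: measurable_funPTI (measurable_itv i). Qed.

Lemma sum_cells_le1 (X : {RV P >-> R}) (a h : R) (K : nat) : 0 <= h ->
  (\sum_(k < K) P (X @^-1` `[(a + k%:R * h)%R, (a + k%:R * h + h)%R[) <= 1)%E.
Proof.
move=> h0.
pose F (k : nat) := X @^-1` `[(a + k%:R * h)%R, (a + k%:R * h + h)%R[.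
have mF k : measurable (F k) by exact: measurable_RV_itv.
have tF : trivIset setT F.
  apply/trivIsetP => i j _ _; wlog ij : i j / (i < j)%N => [hw neq|_].
    case: (ltngtP i j) (neq) => [ij _|ji _|-> //].
      exact: hw.
    by rewrite setIC; apply: hw; rewrite // eq_sym.
  apply/seteqP; split=> // t []; rewrite /F /= !in_itv /= => /andP[_ h1] /andP[h2 _].
  have : (i.+1)%:R * h <= j%:R * h by rewrite ler_wpM2r // ler_nat.
  by rewrite mulrSr mulrDl mul1r; lra.
have mU : measurable (\big[setU/set0]_(k < K) F k) by apply: bigsetU_measurable.
rewrite -(measure_semi_additive F K) //; exact: probability_le1.
Qed.

End Prob.

(** * Small values of linear forms with private pivots *)

Section Forms.
Variables (R : realType) (disp : measure_display) (T : measurableType disp).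
Variables (P : probability T R) (m : nat) (W : 'I_m -> {RV P >-> R}) (phi : R).
Hypothesis phi_gt0 : 0 < phi.
Hypothesis indepW : mutually_independent W.
Hypothesis densW : forall i, density_at_most (W i) phi.

Lemma exists_cell (h z : R) (K : nat) : 0 < h -> 2 <= K%:R * h -> -1 <= z <= 1 ->
  exists k : 'I_K.+1, -1 + k%:R * h <= z < -1 + k%:R * h + h.
Proof.
move=> h0 Kh /andP[z1 z2].
have ex : exists k, z < -1 + k%:R * h + h by exists K; lra.
case: (ex_minnP ex) => k zk mink.
have kK : (k < K.+1)%N by rewrite ltnS; apply: mink; lra.
exists (Ordinal kK); rewrite /= zk andbT.
case: k zk mink {kK} => [|k] zk mink; first by rewrite mul0r addr0.
rewrite leNgt; apply/negP => zk'.
have := mink k; rewrite ltnn => /(_ _)/negP; apply => //.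
by move: zk'; rewrite mulrSr mulrDl mul1r; lra.
Qed.

Lemma indep_all (A : 'I_m -> set R) : (forall i, measurable (A i)) ->
  P (\bigcap_i (W i @^-1` A i)) = (\prod_i P (W i @^-1` A i))%E.
Proof.
move=> mA; have := indepW [set: 'I_m]%SET mA.
have -> : \bigcap_(i in [set` [set: 'I_m]%SET]) (W i @^-1` A i) = \bigcap_i (W i @^-1` A i).
  by apply/seteqP; split=> t Wt i _; apply: Wt => //=; rewrite inE.
by move=> ->; apply: eq_bigl => i; rewrite inE.
Qed.

(* The coordinates that are not pivots are discretized; once their cells are
   fixed, each form confines its pivot to an interval of length [4 * eta]. *)
Lemma small_forms (J : finType) (I : {set J}) (c : J -> 'I_m -> int)
    (p : J -> 'I_m) (eta : R) : 0 < eta ->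
  (forall x x', x \in I -> x' \in I -> (c x (p x') != 0) = (x == x')) ->
  exists B : set T, [/\ measurable B, (P B <= ((4 * eta * phi) ^+ #|I|)%:E)%E &
    forall t, (forall i, -1 <= W i t <= 1) ->
      (forall x, x \in I -> `|\sum_i (c x i)%:~R * W i t| <= eta) -> B t].
Proof.
move=> eta0 piv.
pose S : R := \sum_(x in I) \sum_i `|(c x i)%:~R|.
have S0 : 0 <= S by apply: sumr_ge0 => x _; apply: sumr_ge0.
(* The grid is so fine that rounding changes a form by at most [eta / 2]. *)
pose K := (Num.bound (4 * S / eta)).+1.
pose h : R := 2 / K%:R.
have K0 : 0 < K%:R :> R by rewrite ltr0n.
have h0 : 0 < h by rewrite divr_gt0.
have Kh : 2 <= K%:R * h by rewrite mulrC divfK ?gt_eqF.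
have Sh : S * h <= eta / 2.
  have : 4 * S / eta < K%:R.
    rewrite (lt_le_trans (archi_boundP _)) ?ler_nat //.
    by rewrite divr_ge0 ?mulr_ge0 // ltW.
  rewrite ltr_pdivrMr // => hK; rewrite /h mulrA ler_pdivrMr //; lra.
pose L (k : 'I_K.+1) : R := -1 + k%:R * h.
pose xof i := [pick x in I | p x == i].
(* With the other weights rounded, a form of size at most [eta] puts its pivot within [3 / 2 * eta]
   of this centre, the pivot coefficient being a nonzero integer. The radius [2 * eta] leaves room
   for a half-open interval. *)
pose lo (ka : {ffun 'I_m -> 'I_K.+1}) i : R := if xof i is Some x
  then - (\sum_(i' | i' != i) (c x i')%:~R * L (ka i')) / (c x i)%:~R - 2 * eta
  else L (ka i).
pose len i : R := if xof i is Some x then 4 * eta else h.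
pose A ka i : set R := `[lo ka i, lo ka i + len i[%classic.
have mA ka i : measurable (A ka i) by apply: measurable_itv.
(* Pivots carry the dummy cell [ord0], so each choice of the remaining cells counts once. *)
pose Fam (ka : {ffun 'I_m -> 'I_K.+1}) := [forall i, xof i ==> (ka i == ord0)].
pose E ka := if Fam ka then \bigcap_i (W i @^-1` A ka i) else set0.
have mE ka : measurable (E ka).
  rewrite /E; case: ifP => // _; apply: fin_bigcap_measurable => // i _.
  exact: measurable_RV_itv.
exists (\bigcup_ka E ka); split.
- exact: measurable_finite_union.
- pose pr i (B : set R) : R := fine (P (W i @^-1` B)).
  have prE i (a : interval R) : P (W i @^-1` [set` a]) = (pr i [set` a])%:E.
    by rewrite fineK // fin_num_measure //; exact: measurable_RV_itv.
  pose D := 4 * eta * phi.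
  have D0 : 0 <= D by rewrite !mulr_ge0 // ltW.
  pose q i (k : 'I_K.+1) : R := if xof i then (if k == ord0 then D else 0)
    else pr i `[L k, L k + h[%classic.
  have pr0 i B : 0 <= pr i B by rewrite fine_ge0.
  have q0 i k : 0 <= q i k by rewrite /q; case: (xof i) => //= _; case: ifP.
  apply: le_trans (union_bound P mE) _.
  apply: (@le_trans _ _ (\sum_(ka : {ffun 'I_m -> 'I_K.+1}) (\prod_i q i (ka i))%:E)%E).
    apply: lee_sum => ka _; rewrite /E; case: ifP => [/forallP famka|_]; last first.
      by rewrite measure0 lee_fin prodr_ge0.
    rewrite (indep_all (mA ka)) (eq_bigr (fun i => (pr i (A ka i))%:E)) => [|i _]; last exact: prE.
    rewrite prodEFin lee_fin; apply: ler_prod => i _; rewrite pr0 /=.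
    rewrite /q /A /lo /len; have := famka i; case: (xof i) => //= x /eqP ->.
    rewrite eqxx -lee_fin -prE; apply: le_trans (interval_bound (densW i) _) _.
      by rewrite lerDl mulr_ge0 // ltW.
    by rewrite lee_fin /D addrAC subrr add0r mulrC.
  (* The sum over all choices factors over the coordinates: a pivot contributes [D], any other
     coordinate at most one by [sum_cells_le1]. *)
  rewrite sumEFin lee_fin -bigA_distr_bigA /=.
  apply: (@le_trans _ _ (\prod_(i | xof i : bool) D)).
    rewrite [leRHS]big_mkcond; apply: ler_prod => i _.
    rewrite sumr_ge0 //= /q; case: (xof i) => [x|] /=.
      rewrite (bigD1 ord0) //= big1 ?addr0 // => k /negPf ->; by [].
    rewrite -lee_fin -sumEFin; under eq_bigr do rewrite -prE.
    by apply: sum_cells_le1; rewrite ltW.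
  rewrite prodr_const (_ : #|_| = #|I|) //.
  have inj_p : {in I &, injective p}.
    move=> x x' xI x'I pxx'; apply/eqP; rewrite -(piv _ _ xI x'I) -pxx'.
    by rewrite piv.
  rewrite -(card_in_imset inj_p); apply: eq_card => i; rewrite unfold_in.
  apply/idP/imsetP => [|[x xI ->]]; rewrite /xof; case: pickP => //=.
    by move=> x /andP[xI /eqP <-] _; exists x.
  by move=> /(_ x); rewrite xI eqxx.
- move=> t Wt small.
  have /fin_all_exists [ka hka] i : exists k : 'I_K.+1,
      if xof i is Some _ then k = ord0 else L k <= W i t < L k + h.
    case: (xof i) => [x|]; first by exists ord0.
    exact: exists_cell.
  exists [ffun i => ka i] => //; rewrite /E.
  have -> : Fam [ffun i => ka i].
    by apply/forallP => i; rewrite ffunE; have := hka i; case: (xof i) => //= _ ->.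
  move=> i _; rewrite /A /= in_itv /= /lo /len.
  case Exi : (xof i) => [x|]; last by rewrite ffunE; have := hka i; rewrite Exi.
  have [xI /eqP pxi] : x \in I /\ p x == i.
    by move: Exi; rewrite /xof; case: pickP => // x' /andP[? ?] [<-].
  have ci : c x i != 0 by rewrite -pxi piv.
  set cx : R := (c x i)%:~R; have cx0 : cx != 0 by rewrite intr_eq0.
  have cx1 : 1 <= `|cx| by rewrite /cx -intr_norm ler1z -gtz0_ge1 normr_gt0.
  set Sig := \sum_(i' | _) _.
  have bound : `|cx * W i t + Sig| <= eta + eta / 2.
    have -> : cx * W i t + Sig = \sum_i' (c x i')%:~R * W i' t -
        \sum_(i' | i' != i) (c x i')%:~R * (W i' t - L ([ffun i => ka i] i')).
      rewrite (bigD1 i) //= /Sig; under [X in _ = _ - X]eq_bigr do rewrite mulrBr.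
      by rewrite sumrB; ring.
    apply: le_trans (ler_normB _ _) _; apply: lerD; first exact: small.
    apply: le_trans (ler_norm_sum _ _ _) _; apply: le_trans Sh.
    apply: (@le_trans _ _ (\sum_i' `|(c x i')%:~R| * h)).
      rewrite [leRHS](bigID (fun i' => i' != i)) /= -[leLHS]addr0 lerD //; last first.
        by apply: sumr_ge0 => i' _; rewrite mulr_ge0 // ltW.
      apply: ler_sum => i' i'i; rewrite normrM ffunE.
      case Exi' : (xof i') => [x'|].
        have [x'I /eqP px'i'] : x' \in I /\ p x' == i'.
          by move: Exi'; rewrite /xof; case: pickP => // x'' /andP[? ?] [<-].
        have : c x i' == 0.
          rewrite -px'i'; apply/negPn; rewrite piv //; apply/eqP => xx'.
          by move: i'i; rewrite -px'i' -xx' pxi eqxx.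
        by move/eqP ->; rewrite normr0 !mul0r.
      have := hka i'; rewrite Exi' => /andP[l1 l2].
      by rewrite ler_wpM2l // ger0_norm; lra.
    rewrite -mulr_suml; apply: ler_wpM2r; first exact: ltW.
    rewrite /S (bigD1 x) //= lerDl; apply: sumr_ge0 => x' _; exact: sumr_ge0.
  have : `|W i t + Sig / cx| <= eta + eta / 2.
    have -> : W i t + Sig / cx = (cx * W i t + Sig) / cx by rewrite mulrDl mulrAC mulfV // mul1r.
    rewrite normrM normfV ler_pdivrMr ?(lt_le_trans ltr01) // (le_trans bound) //.
    by rewrite ler_peMr //; lra.
  rewrite ler_norml mulNr => /andP[]; lra.
Qed.

End Forms.

(** * Encoding a window of moves *)

Section Pairing.
Variables (V : finType).
Implicit Types (tau : nat -> V -> bool) (a : nat -> int).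

Lemma pairingC tau i j a x y : pairing tau i j a x y = pairing tau i j a y x.
Proof. by apply: eq_bigr => t _; rewrite andbC [tau t x && _]andbC. Qed.

Lemma pairing_diag tau i j a x : \sum_(i <= t < j) a t * delta tau t x = 0 ->
  pairing tau i j a x x = 0.
Proof. by move=> <-; apply: eq_bigr => t _; rewrite /delta !andbb. Qed.

Lemma pairing_shift tau i j a x y : (i <= j)%N ->
  pairing tau i j a x y =
  pairing (fun t => tau (i + t)%N) 0 (j - i) (fun t => a (i + t)%N) x y.
Proof.
move=> ij; rewrite /pairing -{1}[i]add0n -{1}(subnK ij) big_addn addnK.
by apply: eq_bigr => t _; rewrite addnS addnC.
Qed.

Lemma sum_delta_shift tau i j a x : (i <= j)%N ->
  \sum_(i <= t < j) a t * delta tau t x =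
  \sum_(0 <= t < j - i) a (i + t)%N * delta (fun t => tau (i + t)%N) t x.
Proof.
move=> ij; rewrite -{1}[i]add0n -{1}(subnK ij) big_addn addnK.
by apply: eq_bigr => t _; rewrite /delta addnS addnC.
Qed.

Lemma pairing_const tau b a x y : (forall t, (t <= b)%N -> tau t y = tau 0%N y) ->
  \sum_(0 <= t < b) a t * delta tau t x = 0 -> pairing tau 0 b a x y = 0.
Proof.
move=> cst sum0; rewrite -[RHS](mul0r (tau 0%N y)%:R) -sum0 mulr_suml /pairing.
rewrite !big_nat; apply: eq_bigr => t /andP[_ tb]; rewrite /delta !cst ?(ltnW tb) //.
by case: (tau 0%N y); rewrite ?andbT ?andbF ?subrr ?mulr0 ?mulr1.
Qed.

(** A pair with an untouched coordinate has pairing zero for both walks by [pairing_const]; on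
    touched pairs the walks coincide. *)
Lemma pairing_agree tau tau' (touched : pred V) b a x y :
  (forall z t, (t <= b)%N -> touched z -> tau t z = tau' t z) ->
  (forall z t, (t <= b)%N -> ~~ touched z -> tau t z = tau 0%N z /\ tau' t z = tau' 0%N z) ->
  (forall z, \sum_(0 <= t < b) a t * delta tau t z = 0) ->
  (forall z, \sum_(0 <= t < b) a t * delta tau' t z = 0) /\
  pairing tau 0 b a x y = pairing tau' 0 b a x y.
Proof.
move=> agree cst sum0.
have sum0' z : \sum_(0 <= t < b) a t * delta tau' t z = 0.
  have [tz|tz] := boolP (touched z).
    rewrite -[RHS](sum0 z) !big_nat; apply: eq_bigr => t /andP[_ tb].
    by rewrite /delta !agree // ltnW.
  rewrite big_nat big1 // => t /andP[_ tb]; rewrite /delta.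
  have [_ ->] := cst z t.+1 tb tz; have [_ ->] := cst z t (ltnW tb) tz.
  by rewrite subrr mulr0.
split=> //.
have [ty|ty] := boolP (touched y); last first.
  by rewrite !pairing_const // => t tb; have [] := cst y t tb ty.
have [tx|tx] := boolP (touched x); last first.
  rewrite ![pairing _ _ _ _ x y]pairingC.
  by rewrite !pairing_const // => t tb; have [] := cst x t tb tx.
rewrite /pairing !big_nat; apply: eq_bigr => t /andP[_ tb].
by rewrite !agree // ltnW.
Qed.

End Pairing.

(* A letter [(u, v, p, q)] flips [u] and [v] (a single flip if [u = v]) and
   records their values [p] and [q] at the start of the window. *)
Definition letter (n : nat) := ('I_n * 'I_n * bool * bool)%type.

Section Code.
Variables (n b : nat) (cd : {ffun 'I_b -> letter n}).

Definition code_flips (t : nat) (x : 'I_n) : bool :=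
  if insub t is Some s then (x == (cd s).1.1.1) || (x == (cd s).1.1.2) else false.

(** Variables that no letter mentions start at [false]; [pairing_agree] makes this choice
    harmless. *)
Definition code_init (x : 'I_n) : bool :=
  [exists s, ((cd s).1.1.1 == x) && (cd s).1.2 || ((cd s).1.1.2 == x) && (cd s).2].

Fixpoint code_walk (t : nat) (x : 'I_n) : bool :=
  if t is s.+1 then code_walk s x (+) code_flips s x else code_init x.

Definition code_circulation (K : nat) (a : nat -> int) : Prop :=
  (forall t, `|a t| <= K%:R) /\
  forall x, \sum_(0 <= t < b) a t * delta code_walk t x = 0.

Definition rich (C K : nat) : Prop :=
  exists (I : {set 'I_n}) (a : 'I_n -> nat -> int) (y : 'I_n -> 'I_n),
    [/\ (b <= C * #|I|)%N, forall x, x \in I -> code_circulation K (a x) &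
      forall x x', x \in I -> x' \in I ->
        (pairing code_walk 0 b (a x) x' (y x') != 0) = (x == x')].

End Code.

Section Window.
Variables (n i j : nat) (sigma : nat -> 'I_n -> bool) (u v : nat -> 'I_n).
Hypothesis step : forall t x, (i <= t < j)%N ->
  sigma t.+1 x = sigma t x (+) ((x == u t) || (x == v t)).

Definition window_code : {ffun 'I_(j - i) -> letter n} :=
  [ffun s : 'I_(j - i) => (u (i + s)%N, v (i + s)%N, sigma i (u (i + s)%N), sigma i (v (i + s)%N))].

Lemma window_code_walk : exists touched : pred 'I_n,
  (forall z t, (t <= j - i)%N -> touched z ->
     sigma (i + t)%N z = code_walk window_code t z) /\
  (forall z t, (t <= j - i)%N -> ~~ touched z ->
     sigma (i + t)%N z = sigma (i + 0)%N z /\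
     code_walk window_code t z = code_walk window_code 0 z).
Proof.
pose touched z := [exists s : 'I_(j - i), (u (i + s)%N == z) || (v (i + s)%N == z)].
have flipsE t z : (t < j - i)%N ->
    code_flips window_code t z = (z == u (i + t)%N) || (z == v (i + t)%N).
  by move=> tb; rewrite /code_flips insubT ffunE.
have stp t z : (t < j - i)%N -> sigma (i + t.+1)%N z = sigma (i + t)%N z (+) code_flips window_code t z.
  move=> tb; rewrite addnS step ?flipsE // leq_addr /=.
  by rewrite -ltn_subRL.
exists touched; split=> z t tb tz.
- elim: t tb => [_|t IHt tb]; last by rewrite stp //= IHt // ltnW.
  rewrite addn0 /= /code_init; apply/idP/existsP => [sz|[s]].
    case/existsP: tz => s h; exists s; rewrite ffunE /=.
    by case/orP: h => /eqP h; rewrite h eqxx sz ?orbT.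
  by rewrite ffunE /= => /orP[/andP[/eqP -> ]|/andP[/eqP ->]].
- have nf s : (s < j - i)%N -> code_flips window_code s z = false.
    move=> sb; rewrite flipsE //; apply/negP => h.
    move/negP: tz; apply; apply/existsP; exists (Ordinal sb) => /=.
    by case/orP: h => /eqP ->; rewrite eqxx ?orbT.
  elim: t tb => [//|t IHt tb]; have [h1 h2] := IHt (ltnW tb).
  by rewrite stp //= nf // !addbF.
Qed.

End Window.

(** * From pairings to forms in the weights *)

Section Instance.
Variables (n m d : nat) (I : bfop n m d).

(** The mixed second difference: the coefficient of the product when [g] is written as a polynomial
    in two 0/1 arguments. *)
Definition interaction (g : bool -> bool -> 'I_d.+1) : int :=
  (g true true)%:Z + (g false false)%:Z - (g true false)%:Z - (g false true)%:Z.

Lemma interaction_neq0 g : ~ separable g -> interaction g != 0.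
Proof.
move=> nsep; apply: contra_notN nsep => /eqP g0.
exists (fun p => (g p false)%:Z), (fun q => (g false q)%:Z - (g false false)%:Z).
by move: g0; rewrite /interaction => g0 [] []; lia.
Qed.

Definition pair_form (Q : 'I_n -> 'I_n -> int) (i : 'I_m) : int :=
  match I i with
  | Unary _ _ => 0
  | Binary u v _ g => interaction g * Q u v
  end.

(* A combination of moves in which the linear terms cancel only sees the
   pairwise interactions. *)
Lemma pair_formP (sigma : nat -> assignment n) i j (a : nat -> int) (k : 'I_m) :
  (forall x, \sum_(i <= t < j) a t * delta (fun t => sigma t) t x = 0) ->
  \sum_(i <= t < j) a t *
    ((bfop_eval (I k) (sigma t.+1))%:Z - (bfop_eval (I k) (sigma t))%:Z) =
  pair_form (pairing (fun t => sigma t) i j a) k.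
Proof.
move=> sum0; rewrite /pair_form; case: (I k) => [x g|x y xy g] /=.
  transitivity (((g true)%:Z - (g false)%:Z) * \sum_(i <= t < j) a t * delta (fun t => sigma t) t x).
    rewrite mulr_sumr; apply: eq_bigr => t _; rewrite /delta.
    by case: (sigma t.+1 x); case: (sigma t x) => /=; ring.
  by rewrite sum0 mulr0.
transitivity (interaction g * pairing (fun t => sigma t) i j a x y
  + ((g true false)%:Z - (g false false)%:Z) * \sum_(i <= t < j) a t * delta (fun t => sigma t) t x
  + ((g false true)%:Z - (g false false)%:Z) * \sum_(i <= t < j) a t * delta (fun t => sigma t) t y).
  rewrite /pairing !mulr_sumr -!big_split; apply: eq_bigr => t _ /=.
  rewrite /delta /interaction.
  by case: (sigma t.+1 x); case: (sigma t x); case: (sigma t.+1 y); case: (sigma t y) => /=; ring.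
by rewrite !sum0 !mulr0 !addr0.
Qed.

End Instance.

(** * The event that some rich code has only small forms *)

Section Bad.
Variables (R : realType) (disp : measure_display) (T : measurableType disp).
Variables (P : probability T R) (n m d : nat) (I : bfop n m d).
Variables (W : 'I_m -> {RV P >-> R}) (phi : R).
Hypothesis phi_gt0 : 0 < phi.
Hypothesis indepW : mutually_independent W.
Hypothesis densW : forall i, density_at_most (W i) phi.
Hypothesis completeI : complete_bfop I.
Variables (C K : nat) (rho eta : R).
Hypothesis rho_gt0 : 0 < rho.
Hypothesis rho_le1 : rho <= 1.
Hypothesis eta_gt0 : 0 < eta.
Hypothesis etaE : 4 * eta * phi = rho ^+ C.

Definition code_small b (cd : {ffun 'I_b -> letter n}) (t : T) : Prop :=
  forall a, code_circulation cd K a ->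
    `|\sum_i (pair_form I (pairing (code_walk cd) 0 b a) i)%:~R * W i t| <= eta.

(** Completeness provides a nonseparable function on each pair [x], [y x]; its weight is the pivot
    of the form of [x], as the pairings are diagonal. At least [b / C] forms each contribute a
    factor [rho ^+ C]. *)
Lemma code_bad b (cd : {ffun 'I_b -> letter n}) :
  exists B : set T, [/\ measurable B, (P B <= (rho ^+ b)%:E)%E &
    forall t, (forall i, -1 <= W i t <= 1) -> rich cd C K -> code_small cd t -> B t].
Proof.
have [b0|b_gt0] := posnP b.
  by exists setT; split=> //; rewrite b0 expr0 probability_setT.
have [rcd|nrcd] := pselect (rich cd C K); last first.
  exists set0; split=> //; by rewrite measure0 lee_fin exprn_ge0 // ltW.
have [J [a [y [bJ circ diag]]]] := rcd.
have neq_xy x : x \in J -> x != y x.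
  move=> xJ; apply/eqP => xy; have := diag x x xJ xJ.
  by rewrite -xy pairing_diag ?eqxx //; have [_ ->] := circ _ xJ.
have /fin_all_exists [p hp] x : exists i : 'I_m, x \in J ->
    match I i with
    | Unary _ _ => False
    | Binary u v _ g => [set u; v]%SET = [set x; y x]%SET /\ ~ separable g
    end.
  have [xJ|xJ] := boolP (x \in J).
    by have [i hi] := completeI (neq_xy _ xJ); exists i.
  have [[i _]|none] := pselect (exists i : 'I_m, True); first by exists i.
  have [J0|[x' x'J]] := set_0Vmem J.
    by move: bJ; rewrite J0 cards0 muln0 leqNgt b_gt0.
  have [i _] := completeI (neq_xy _ x'J); by exfalso; apply: none; exists i.
pose c x i := pair_form I (pairing (code_walk cd) 0 b (a x)) i.
have piv x x' : x \in J -> x' \in J -> (c x (p x') != 0) = (x == x').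
  move=> xJ x'J; rewrite -(diag x x' xJ x'J) /c /pair_form.
  have := hp _ x'J; case: (I (p x')) => // u v uv g [uvE /interaction_neq0 g0].
  rewrite mulf_eq0 (negPf g0) /=.
  have : ((u == x') && (v == y x')) || ((u == y x') && (v == x')).
    have : u \in [set x'; y x']%SET by rewrite -uvE !inE eqxx.
    have : v \in [set x'; y x']%SET by rewrite -uvE !inE eqxx orbT.
    rewrite !inE => /orP[] /eqP vE /orP[] /eqP uE; move: uv; by rewrite uE vE ?eqxx ?orbT.
  by case/orP => /andP[/eqP -> /eqP ->] //; rewrite pairingC.
have [B [mB PB HB]] := small_forms phi_gt0 indepW densW eta_gt0 piv.
exists B; split=> //.
  apply: le_trans PB _; rewrite etaE lee_fin -exprM.
  by apply: ler_wiXn2l => //; rewrite ltW.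
move=> t Wt _ small; apply: HB => // x xJ; apply: small; exact: circ.
Qed.

(** There are [(4 * n ^ 2) ^ b] codes of length [b], so the union bound is a geometric series with
    ratio [s <= 1 / (2 * n)], and its sum is at most [2 * s]. *)
Lemma bad_event l : (0 < n)%N -> rho <= (8 * n%:R ^+ 3)^-1 ->
  exists B : set T, [/\ measurable B, (P B <= (n%:R^-1)%:E)%E &
    forall t, (forall i, -1 <= W i t <= 1) ->
      forall b (cd : {ffun 'I_b -> letter n}), (0 < b <= l)%N ->
        rich cd C K -> code_small cd t -> B t].
Proof.
move=> n0 rho_small.
have H b : exists B : set T, [/\ measurable B,
    (P B <= ((4 * n%:R ^+ 2 * rho) ^+ b)%:E)%E &
    forall t, (forall i, -1 <= W i t <= 1) ->
      forall cd : {ffun 'I_b -> letter n}, rich cd C K -> code_small cd t -> B t].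
  have /fin_all_exists [B hB] cd := @code_bad b cd.
  have mB cd : measurable (B cd) by have [] := hB cd.
  exists (\bigcup_cd B cd); split.
  - exact: measurable_finite_union.
  - apply: le_trans (union_bound P mB) _.
    apply: (@le_trans _ _ (\sum_(cd : {ffun 'I_b -> letter n}) (rho ^+ b)%:E)%E).
      by apply: lee_sum => cd _; have [] := hB cd.
    rewrite sumEFin lee_fin sumr_const -[_ *+ _]mulr_natl.
    have -> : #|{: {ffun 'I_b -> letter n}}| = ((4 * n ^ 2) ^ b)%N.
      rewrite card_ffun card_ord !card_prod card_bool card_ord; congr (_ ^ _)%N.
      by rewrite -mulnn; clear; lia.
    by rewrite natrX natrM natrX -exprMn.
  - move=> t Wt cd rcd small; exists cd => //.
    by have [_ _] := hB cd; apply.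
have [B hB] := choice H.
have mB (b : 'I_l) : measurable (B b.+1) by have [] := hB b.+1.
exists (\bigcup_(b : 'I_l) B b.+1); split.
- exact: measurable_finite_union.
- apply: le_trans (union_bound P mB) _.
  have n1 : 1 <= n%:R :> R by rewrite ler1n.
  set s := 4 * n%:R ^+ 2 * rho in hB *.
  have s0 : 0 <= s by rewrite !mulr_ge0 // ?exprn_ge0 ?ltW.
  have hs : s <= (2 * n%:R)^-1.
    have e : (2 * n%:R)^-1 = 4 * n%:R ^+ 2 * (8 * n%:R ^+ 3)^-1 :> R.
      have : n%:R != 0 :> R by rewrite pnatr_eq0 -lt0n.
      by move=> ?; field.
    by rewrite e ler_wpM2l // mulr_ge0 // exprn_ge0.
  have hs2 : s <= 1 / 2.
    by apply: le_trans hs _; rewrite div1r lef_pV2 ?posrE ?mulr_gt0 ?ltr0n //; lra.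
  apply: (@le_trans _ _ (2 * s)%:E); last first.
    rewrite lee_fin; have : 2 * (2 * n%:R)^-1 = n%:R^-1 :> R.
      by rewrite invfM mulVKf.
    by move: hs; lra.
  apply: (@le_trans _ _ (\sum_(b < l) (s ^+ b.+1)%:E)%E).
    by apply: lee_sum => b _; have [] := hB b.+1.
  rewrite sumEFin lee_fin.
  suff : \sum_(b < l) s ^+ b.+1 <= 2 * s - 2 * s * s ^+ l.
    by move/le_trans; apply; rewrite gerBl mulr_ge0 ?exprn_ge0 // mulr_ge0.
  elim: l {mB} => [|k IHk]; first by rewrite big_ord0 expr0 mulr1 subrr.
  rewrite big_ord_recr /= exprS; apply: (le_trans (lerD IHk (lexx _))).
  have := mulr_ge0 s0 (exprn_ge0 k s0); move: (s ^+ k) => sk; nra.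
- move=> t Wt b cd /andP[b0 bl] rcd small.
  case: b cd b0 bl rcd small => // b cd _ bl rcd small.
  exists (Ordinal bl) => //=; have [_ _ h] := hB b.+1; exact: (h t Wt cd).
Qed.

End Bad.

(* The factors come from the length of the window in [exists_dense_window], the
   proportion of good vertices in [many_good] and the loss in
   [independent_certificates]. *)
Definition rich_const (J : nat) : nat :=
  32 * (16 * 401 * J) * 8 * 32 * (3 * (2 * J + 1)) ^ 2.

(** * Rich windows in an execution *)

Section Run.
Variables (R : realType) (n m d l : nat) (I : bfop n m d) (w : 'I_m -> R).
Variable sigma : nat -> assignment n.
Hypothesis sigma_step : forall t, (t < l)%N -> two_flip_step I w (sigma t) (sigma t.+1).

Let obj t : R := objective I w (sigma t).

Lemma obj_lt s t : (s < t)%N -> (t <= l)%N -> obj s < obj t.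
Proof.
elim: t => [//|t IHt]; rewrite ltnS leq_eqVlt => st tl.
have lt1 : obj t < obj t.+1 by case/existsP: (sigma_step tl) => S /and4P[].
by case/orP: st => [/eqP ->//|st]; apply: lt_trans lt1; apply: IHt => //; apply: ltnW.
Qed.

Lemma sigma_inj s t : (s <= l)%N -> (t <= l)%N -> sigma s = sigma t -> s = t.
Proof.
move=> sl tl; rewrite -[in X in _ -> X]/(s = t) => st.
case: (ltngtP s t) => // [/obj_lt/(_ tl)|/obj_lt/(_ sl)]; by rewrite /obj st ltxx.
Qed.

Lemma exists_flips : (0 < n)%N -> exists u v : nat -> 'I_n, forall t x, (t < l)%N ->
  sigma t.+1 x = sigma t x (+) ((x == u t) || (x == v t)).
Proof.
move=> n0.
have H t : exists q : 'I_n * 'I_n, (t < l)%N -> forall x,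
    sigma t.+1 x = sigma t x (+) ((x == q.1) || (x == q.2)).
  have [tl|] := ltnP t l; last by exists (Ordinal n0, Ordinal n0).
  case/existsP: (sigma_step tl) => S /and4P[/andP[S0 S2] /eqP -> _ _].
  have [u [v Suv]] : exists u v, S = [set u; v]%SET.
    move: S0 S2; case cS : #|S| => [|[|[|]]] // _ _.
      have /cards1P[u ->] : #|S| == 1%N by rewrite cS.
      by exists u, u; rewrite finset.setUid.
    have /cards2P[u [v]] : #|S| == 2%N by rewrite cS.
    by case=> _ ->; exists u, v.
  exists (u, v) => _ x; rewrite ffunE Suv !inE /=.
  by case: (_ || _); rewrite ?addbT ?addbF.
have [q hq] := choice H; exists (fun t => (q t).1), (fun t => (q t).2) => t x tl.
exact: hq.
Qed.

(** The code forgets the variables that its window leaves alone, yet its forms equal the true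
    combined gains: sums of positive step gains with coefficients of size at most [2 * J + 1],
    within a window of the block. *)
Lemma run_rich_code J : (0 < n)%N -> (0 < J)%N -> (n.+1 < 2 ^ J)%N ->
  (8 * (16 * 401 * J) * n.+1 <= l)%N ->
  exists b (cd : {ffun 'I_b -> letter n}), [/\ (0 < b <= l)%N,
    rich cd (rich_const J) (2 * J + 1) &
    forall a, code_circulation cd (2 * J + 1) a ->
      `|\sum_i (pair_form I (pairing (code_walk cd) 0 b a) i)%:~R * w i|
        <= (2 * J + 1)%:R * (obj l - obj 0)].
Proof.
move=> n0 J0 nJ hl.
have [u [v uv]] := exists_flips n0.
(* [None] is the parity coordinate, flipped together with [u t] by single flips. *)
pose tau t (z : option 'I_n) : bool :=
  if z is Some x then sigma t x else \big[addb/false]_x sigma t x.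
pose e1 t : option 'I_n := Some (u t).
pose e2 t : option 'I_n := if u t == v t then None else Some (v t).
have neq t : (t < l)%N -> e1 t != e2 t.
  by move=> _; rewrite /e1 /e2; case: (eqVneq (u t) (v t)).
have stp t z : (t < l)%N -> tau t.+1 z = tau t z (+) ((z == e1 t) || (z == e2 t)).
  move=> tl; case: z => [x|].
    rewrite /tau uv // /e1 /e2; congr (_ (+) _).
    by case: (eqVneq (u t) (v t)) => [->|_]; rewrite ?orbb ?orbF.
  rewrite /tau /=; under eq_bigr do rewrite uv //.
  rewrite big_split /=; congr (_ (+) _); rewrite /e2.
  case: (eqVneq (u t) (v t)) => [->|uvt].
    rewrite (bigD1 (v t)) //= big1 ?eqxx // => x /negPf ->; by rewrite orbb.
  rewrite (bigD1 (u t)) //= (bigD1 (v t)) /=; last by rewrite eq_sym.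
  by rewrite big1 ?eqxx ?orbT // => x /andP[/negPf -> /negPf ->].
have inj s t : (s <= l)%N -> (t <= l)%N -> tau s =1 tau t -> s = t.
  move=> sl tl st; apply: sigma_inj => //.
  by apply/ffunP => x; have := st (Some x).
have [||i [j [A [a [y [[/andP[ij jl] A0] bA realA circA diagA]]]]]] :=
  @exists_rich_window _ None tau e1 e2 l neq stp inj J J0.
- by rewrite card_option card_ord.
- by rewrite card_option card_ord.
pose A' := [set x : 'I_n | Some x \in A]%SET.
pose y' x := odflt x (y (Some x)).
have yE x : x \in A' -> y (Some x) = Some (y' x).
  by rewrite inE => /realA /andP[_]; rewrite /y'; case: (y (Some x)).
have cA : #|A| = #|A'|.
  have -> : A = (Some @: A')%SET.
    apply/setP => -[x|]; first by rewrite mem_imset ?inE //; exact: Some_inj.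
    apply/idP/imsetP => [/realA|[x _ //]]; by rewrite eqxx.
  by rewrite card_imset //; exact: Some_inj.
pose sg t x : bool := sigma t x.
have stpw t x : (i <= t < j)%N -> sg t.+1 x = sg t x (+) ((x == u t) || (x == v t)).
  by case/andP=> _ tj; apply: uv; apply: leq_trans jl.
have [touched [agree cst]] := window_code_walk stpw.
set cd := window_code i j sg u v in agree cst.
exists (j - i)%N, cd; split.
- by rewrite subn_gt0 ij (leq_trans (leq_subr _ _)).
- have sum0 x : x \in A' -> forall z,
      \sum_(0 <= t < j - i) a (Some x) (i + t)%N * delta (fun t => sg (i + t)%N) t z = 0.
    rewrite inE => /circA[_ _ circx] z.
    by rewrite -(@sum_delta_shift _ sg) ?(ltnW ij) //; exact: (circx (Some z)).
  have pE x xA x' z := @pairing_agree _ (fun t => sg (i + t)%N) (code_walk cd) touched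
    (j - i) (fun t => a (Some x) (i + t)%N) x' z agree cst (sum0 x xA).
  exists A', (fun x t => a (Some x) (i + t)%N), y'; split.
  + by rewrite /rich_const -cA.
  + move=> x xA; split=> [t|]; last by have [] := pE x xA x x.
    by have := xA; rewrite inE => /circA[_ + _]; apply.
  + move=> x x' xA x'A; have [_ <-] := pE x xA x' (y' x').
    rewrite -(@pairing_shift _ sg) ?(ltnW ij) //.
    have := xA; rewrite inE => xA'; have := x'A; rewrite inE => x'A'.
    by have := diagA _ _ xA' x'A'; rewrite (yE _ x'A) => ->.
- move=> c [c1 c2].
  have agree' z t : (t <= j - i)%N -> touched z -> code_walk cd t z = sg (i + t)%N z.
    by move=> tb tz; rewrite agree.
  have cst' z t : (t <= j - i)%N -> ~~ touched z ->
      code_walk cd t z = code_walk cd 0 z /\ sg (i + t)%N z = sg (i + 0)%N z.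
    by move=> tb tz; have [] := cst z t tb tz.
  have pE x z := @pairing_agree _ (code_walk cd) (fun t => sg (i + t)%N) touched
      (j - i) c x z agree' cst' c2.
  have sum0 : forall z, \sum_(0 <= t < j - i) c t * delta (fun t => sg (i + t)%N) t z = 0.
    by move=> z; have [] := pE z z.
  have -> : \sum_k (pair_form I (pairing (code_walk cd) 0 (j - i) c) k)%:~R * w k =
      \sum_(0 <= t < j - i) (c t)%:~R * (obj (i + t).+1 - obj (i + t)%N).
    transitivity (\sum_k \sum_(0 <= t < j - i) (c t)%:~R *
      (w k * (bfop_eval (I k) (sigma (i + t).+1))%:R - w k * (bfop_eval (I k) (sigma (i + t)%N))%:R)).
      apply: eq_bigr => k _.
      have -> : pair_form I (pairing (code_walk cd) 0 (j - i) c) k =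
          pair_form I (pairing (fun t => sg (i + t)%N) 0 (j - i) c) k.
        by rewrite /pair_form; case: (I k) => // x z _ g; have [_ ->] := pE x z.
      have := @pair_formP n m d I (fun t => sigma (i + t)%N) 0 (j - i) c k sum0.
      rewrite /sg => <-; rewrite rmorph_sum /= mulr_suml; apply: eq_bigr => t _.
      by rewrite addnS rmorphM rmorphB /= !pmulrn; ring.
    rewrite exchange_big /=; apply: eq_bigr => t _.
    by rewrite -mulr_sumr sumrB.
  apply: le_trans (ler_norm_sum _ _ _) _.
  apply: (@le_trans _ _ (\sum_(0 <= t < j - i) (2 * J + 1)%:R * (obj (i + t).+1 - obj (i + t)%N))).
    rewrite big_nat [leRHS]big_nat; apply: ler_sum => t /andP[_ tb].
    have til : (i + t < l)%N by apply: leq_trans jl; rewrite -ltn_subRL.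
    have h := obj_lt (ltnSn (i + t)) til.
    rewrite normrM [X in _ * X]ger0_norm ?subr_ge0 ?(ltW h) //.
    apply: ler_wpM2r; first by rewrite subr_ge0 ltW.
    by have := c1 t; rewrite -(ler_int R) intr_norm rmorph_nat.
  rewrite -mulr_sumr ler_wpM2l //.
  have -> : \sum_(0 <= t < j - i) (obj (i + t).+1 - obj (i + t)%N) = obj j - obj i.
    have := @telescope_sumr R 0 (j - i) (fun t => obj (i + t)%N) (leq0n _).
    rewrite addn0 subnKC ?(ltnW ij) // => <-.
    by apply: eq_bigr => t _; rewrite addnS.
  have objle s t : (s <= t)%N -> (t <= l)%N -> obj s <= obj t.
    by rewrite leq_eqVlt => /orP[/eqP -> //|st] tl; apply/ltW/obj_lt.
  by apply: lerB; apply: objle => //; apply: leq_trans jl; apply: ltnW.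
Qed.

End Run.

(** * The length of an execution *)

Definition block_length (n J : nat) : nat := 8 * (16 * 401 * J) * n.+1.

Lemma rich_const_le : exists c, forall J, (0 < J)%N -> (rich_const J <= c * J ^ 3)%N.
Proof.
exists (32 * (16 * 401) * 8 * 32 * 81)%N => J J0; rewrite /rich_const.
move: (16 * 401)%N => c.
have h : ((3 * (2 * J + 1)) ^ 2 <= 81 * J ^ 2)%N by rewrite -!mulnn; nia.
apply: (@leq_trans (32 * (c * J) * 8 * 32 * (81 * J ^ 2))%N); first by rewrite leq_mul2l h orbT.
by rewrite (expnS J 2) leq_eqVlt; apply/orP; left; apply/eqP; ring.
Qed.

Lemma polynomial_bound : exists c, forall n d J, (1 < n)%N -> (0 < J <= n.+1)%N ->
  (block_length n J * (8 * d * (2 * J + 1) * (8 * n ^ 3) ^ rich_const J + 3)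
     <= n ^ ((d + c) * J ^ 3))%N.
Proof.
have [c hc] := rich_const_le.
exists (29 + 6 * c)%N => n d J n1 /andP[J0 Jn].
have C_le := hc J J0.
have le_exp2r a b k : (a <= b)%N -> (a ^ k <= b ^ k)%N.
  by case: k => [|k] ab; rewrite ?expn0 // leq_exp2r.
have le_expn k : (2 ^ k <= n ^ k)%N by exact: le_exp2r.
have n2 : (n.+1 <= n ^ 2)%N by rewrite -mulnn; move: n1; clear; nia.
(* The exponent is [3 + 4 + 9 + 2 + 2], for the factors [8], [16], [401], [J] and [n.+1]. *)
have len : (block_length n J <= n ^ 20)%N.
  rewrite /block_length -[8%N]/(2 ^ 3)%N -[16%N]/(2 ^ 4)%N.
  have h401 : (401 <= n ^ 9)%N by apply: leq_trans (le_expn 9%N).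
  have -> : (n ^ 20 = n ^ 3 * (n ^ 4 * n ^ 9 * n ^ 2) * n ^ 2)%N.
    by rewrite -!expnD.
  by rewrite !leq_mul ?le_expn // (leq_trans Jn).
have cube : (8 * n ^ 3 <= n ^ 6)%N.
  by rewrite -[8%N]/(2 ^ 3)%N (expnD n 3 3) leq_mul.
have big : ((8 * n ^ 3) ^ rich_const J <= n ^ (6 * rich_const J))%N.
  by rewrite expnM; exact: le_exp2r.
move: C_le big; move: (rich_const J) => r C_le big.
apply: (@leq_trans (n ^ 20 * n ^ (9 + d + 6 * r))%N).
  apply: leq_mul => //.
  apply: (@leq_trans (n ^ 3 * n ^ d * (n ^ 4) * n ^ (6 * r) + n ^ 2)%N).
    apply: leq_add; last by apply: leq_trans n2.
    apply: leq_mul big; apply: leq_mul.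
      by apply: leq_mul (le_expn 3%N) _; apply/ltnW/(ltn_expl d n1).
    apply: (@leq_trans (n ^ 2 * n ^ 2)%N); last by rewrite -expnD.
    by move: Jn n2 n1; clear; nia.
  rewrite -!expnD; apply: (@leq_trans (n ^ (8 + d + 6 * r) * 2)%N).
    by rewrite muln2 -addnn leq_add // leq_pexp2l ?(ltnW n1) //; lia.
  have -> : (9 + d + 6 * r = (8 + d + 6 * r).+1)%N by [].
  by rewrite expnSr leq_mul2l n1 orbT.
rewrite -expnD leq_pexp2l ?(ltnW n1) //.
have : (0 < J ^ 3)%N by rewrite expn_gt0 J0.
by move: C_le; move: (J ^ 3)%N; clear; nia.
Qed.

Lemma trunc_log_le_ln (R : realType) n : (1 < n)%N ->
  (trunc_log 2 n.+1).+1%:R <= 6 * ln n%:R :> R /\ 1 <= 2 * ln n%:R :> R.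
Proof.
move=> n1.
(* This comes from [ln (1 - 1 / 2) <= - 1 / 2]. *)
have ln2 : 1 <= 2 * ln 2 :> R.
  have := @le_ln1Dx R (- 2^-1) _; rewrite (_ : 1 + - 2^-1 = 2^-1 :> R); last by lra.
  by rewrite lnV ?posrE //; move=> h; have := h ltac:(lra); lra.
have n_gt0 : 0 < n%:R :> R by rewrite ltr0n ltnW.
have lnn : ln 2 <= ln n%:R :> R by rewrite ler_ln ?posrE // ler_nat.
have h : (trunc_log 2 n.+1)%:R * ln 2 <= ln 2 + ln n%:R :> R.
  rewrite mulr_natl -lnXn // -lnM ?posrE // ler_ln ?posrE ?exprn_gt0 ?mulr_gt0 //.
  rewrite -natrX -natrM ler_nat; apply: leq_trans (trunc_logP _ _) _ => //.
  by rewrite mul2n -addnn -addn1 leq_add2l ltnW.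
split; last by lra.
rewrite -natr1; move: h; set L := ln n%:R in lnn *; set k := (trunc_log _ _)%:R.
have : 0 <= k by rewrite ler0n.
by move: lnn ln2; nra.
Qed.

(** The exponent is cubic in the logarithm; seven factors [2 * ln n%:R], each at least one, raise it
    to the tenth power. *)
Lemma expn_le_powR (R : realType) (c : nat) : exists C : R, forall n, (1 < n)%N ->
  (n ^ (c * (trunc_log 2 n.+1).+1 ^ 3))%:R <= n%:R `^ (C * ln n%:R ^+ 10) :> R.
Proof.
exists (c%:R * (6 ^+ 3 * 2 ^+ 7)) => n n1; have [] := @trunc_log_le_ln R n n1.
set J := (trunc_log _ _).+1; set L := ln _ => hJ hL.
rewrite natrX -powR_mulrn //; apply: ler_powR; first by rewrite ler1n ltnW.
rewrite natrM natrX -mulrA ler_wpM2l //.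
have -> : 6 ^+ 3 * 2 ^+ 7 * L ^+ 10 = (6 * L) ^+ 3 * (2 * L) ^+ 7 by ring.
rewrite -[leLHS]mulr1; apply: ler_pM => //.
  by apply: lerXn2r; rewrite ?nnegrE // (le_trans _ hJ).
exact: exprn_ege1.
Qed.

(** * Measurability of the step bound *)

Section Measurability.
Variables (disp : measure_display) (T : measurableType disp) (R : realType).

(** Membership in [E] depends on finitely many measurable bits, so [E] is the union of the cells of
    bit patterns that it meets. *)
Lemma measurable_pattern (F : finType) (g : F -> T -> bool) (E : set T) :
  (forall p, measurable [set t | g p t]) ->
  (forall s t, (forall p, g p s = g p t) -> E s -> E t) -> measurable E.
Proof.
move=> mg inv.
pose cell (r : {ffun F -> bool}) := \bigcap_p [set t | g p t = r p].
have mcell r : measurable (cell r).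
  apply: fin_bigcap_measurable => // p _; case: (r p); first exact: mg.
  rewrite (_ : [set _ | _] = ~` [set t | g p t]); first exact: measurableC.
  by apply/seteqP; split=> t /=; case: (g p t).
have -> : E = \bigcup_r (if `[< exists2 s, E s & cell r s >] then cell r else set0).
  apply/seteqP; split=> [t Et|t [r _]].
    have ct : cell [ffun p => g p t] t by move=> p _ /=; rewrite ffunE.
    by exists [ffun p => g p t] => //; case: asboolP => // -[]; exists t.
  case: asboolP => // -[s Es cs] ct; apply: inv Es => p.
  by have /= -> := cs p I; have /= -> := ct p I.
by apply: measurable_finite_union => r; case: ifP.
Qed.

(** The weights determine the allowed steps only through comparisons of the objectives of finitely
    many assignments. *)
Lemma measurable_two_flip_within (P : probability T R) n m d (I : bfop n m d)
    (W : 'I_m -> {RV P >-> R}) (b : R) :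
  measurable [set t | two_flip_within I (fun i => W i t) b].
Proof.
pose w t i := W i t.
apply: (@measurable_pattern (assignment n * assignment n)%type
  (fun p t => objective I (w t) p.1 < objective I (w t) p.2)) => [p|s t st] /=.
  have mobj tau : measurable_fun setT (fun t => objective I (w t) tau).
    by apply: measurable_sum => i; apply: measurable_funM.
  rewrite -[X in measurable X]setTI.
  exact: (measurable_fun_ltr (mobj p.1) (mobj p.2) measurableT (Y := [set true])).
have stepE : two_flip_step I (w s) =2 two_flip_step I (w t).
  move=> tau tau'; rewrite /two_flip_step; apply: eq_existsb => S.
  have lt a a' := st (a, a'); rewrite /= in lt.
  rewrite lt; congr [&& _, _, _ & (_ ==> _)].
  by apply: eq_forallb => x; congr (_ ==> _); rewrite !leNgt lt.
by move=> within tau0 q qP; apply: (within tau0); rewrite (eq_path stepE).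
Qed.

End Measurability.

Section Length.
Variables (R : realType) (n m d : nat) (I : bfop n m d) (w : 'I_m -> R).

Lemma objective_bound tau : (forall i, -1 <= w i <= 1) ->
  `|objective I w tau| <= (m * d)%:R.
Proof.
move=> w1; apply: le_trans (ler_norm_sum _ _ _) _.
apply: (@le_trans _ _ (\sum_(i < m) d%:R)); last first.
  by rewrite sumr_const card_ord -[_ *+ _]mulr_natl natrM.
apply: ler_sum => i _; rewrite normrM normr_nat -[leRHS]mul1r.
apply: ler_pM => //; first by rewrite ler_norml.
by rewrite ler_nat; case: (I i) => [x g|x y _ g] /=; rewrite -ltnS.
Qed.

(** Each full block of [l] steps gains more than [gain], while the objective stays in an interval of
    length [2 * (m * d)]; the summand one counts the incomplete last block. *)
Lemma path_length l (gain : R) tau0 s : (0 < l)%N -> 0 < gain ->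
  (forall i, -1 <= w i <= 1) ->
  (forall sigma : nat -> assignment n,
    (forall t, (t < l)%N -> two_flip_step I w (sigma t) (sigma t.+1)) ->
    gain < objective I w (sigma l) - objective I w (sigma 0%N)) ->
  path (two_flip_step I w) tau0 s ->
  (size s)%:R <= l%:R * (2 * (m * d)%:R / gain + 1).
Proof.
move=> l0 gain0 w1 block pths.
pose sg k := nth tau0 (tau0 :: s) k.
have stp k : (k < size s)%N -> two_flip_step I w (sg k) (sg k.+1).
  by move/pathP: pths => h; apply: (h tau0).
have blocks q : (q * l <= size s)%N ->
    q%:R * gain <= objective I w (sg (q * l)%N) - objective I w (sg 0%N).
  elim: q => [_|q IHq qs]; first by rewrite mul0r subrr.
  have ql : (q * l <= size s)%N by apply: leq_trans qs; rewrite leq_mul2r leqnSn orbT.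
  have h := block (fun t => sg (q * l + t)%N).
  have {}h : gain < objective I w (sg (q.+1 * l)%N) - objective I w (sg (q * l)%N).
    have := h; rewrite addn0 -mulSnr; apply=> t tl.
    by rewrite addnS; apply: stp; apply: leq_trans qs; rewrite mulSnr ltn_add2l.
  by rewrite -natr1 mulrDl mul1r; have := IHq ql; lra.
set q := (size s %/ l)%N.
have hq : q%:R * gain <= 2 * (m * d)%:R.
  apply: le_trans (blocks _ (leq_trunc_div _ _)) _.
  have := objective_bound (sg (q * l)%N) w1; have := objective_bound (sg 0%N) w1.
  by rewrite !ler_norml => /andP[? ?] /andP[? ?]; lra.
have hs : (size s)%:R <= (l * q.+1)%:R :> R.
  by rewrite ler_nat ltnW // mulnC ltn_ceil.
apply: le_trans hs _; rewrite natrM ler_wpM2l // -natr1 lerD2r.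
by rewrite ler_pdivlMr.
Qed.

End Length.

Theorem theorem1p3 (R : realType) (d : nat) :
  exists (C : R) (eps : nat -> R),
    eps @ \oo --> 0 /\
    forall (n m : nat) (I : bfop n m d) (phi : R)
      (disp : measure_display) (T : measurableType disp)
      (P : probability T R) (W : 'I_m -> {RV P >-> R}),
      complete_bfop I ->
      0 < phi ->
      mutually_independent W ->
      (forall i, {ae P, forall t, -1 <= W i t <= 1}) ->
      (forall i, density_at_most (W i) phi) ->
      ((1 - eps n)%:E <=
        P [set t | two_flip_within I (fun i => W i t)
                     (m%:R * phi * n%:R `^ (C * ln n%:R ^+ 10))])%E.
Proof.
have [c polyB] := polynomial_bound.
have [C powB] := expn_le_powR R (d + c).
(* This error is [2 / (n + 1)]: at least one for [n <= 1], where the claim is void, and at least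
   [1 / n] otherwise. *)
exists C, (fun n => 2 * harmonic n); split.
  rewrite -[X in _ --> X](mulr0 2); apply: cvgMr; exact: cvg_harmonic.
move=> n m I phi disp T P W completeI phi0 indepW aeW densW.
have [n1|n1] := leqP n 1.
  apply: le_trans (measure_ge0 _ _); rewrite lee_fin subr_le0 /harmonic /=.
  by case: n n1 {I completeI} => [|[|]] // _; lra.
have n0 : (0 < n)%N by exact: ltnW.
pose x0 : 'I_n := Ordinal n0; pose x1 : 'I_n := Ordinal n1.
have [i0 _] := completeI x0 x1 isT.
have m1 : 1 <= m%:R :> R by rewrite ler1n; apply: leq_ltn_trans (ltn_ord i0).
have /fin_all_exists [A hA] i : exists A : set T,
    [/\ measurable A, P A = 0%E & ~` [set t | -1 <= W i t <= 1] `<=` A].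
  exact: aeW.
have mA i : measurable (A i) by have [] := hA i.
(* A half-open interval of length three contains the weight almost surely, so [phi] is at least one
   third. With [m >= 1] this lets [m%:R * phi] absorb the incomplete block. *)
have phi3 : 1 <= 3 * phi.
  have := interval_bound (densW i0) (_ : -1 <= 2); rewrite -lee_fin.
  have -> : phi * (2 - -1) = 3 * phi by ring.
  move=> h; apply: le_trans (h _); last by lra.
  have [_ PA sub] := hA i0.
  rewrite -[leLHS]sube0 -PA -probability_setC //.
  apply: le_measure; rewrite ?inE; [exact: measurableC|exact: measurable_RV_itv|].
  move=> t At; have /andP[h1 h2] : -1 <= W i0 t <= 1.
    by apply/negPn/negP => nW; apply: At; apply: sub; apply/negP.
  by rewrite /= in_itv /= h1; lra.
set J := (trunc_log 2 n.+1).+1.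
have J0 : (0 < J)%N by [].
have nJ : (n.+1 < 2 ^ J)%N by exact: trunc_log_ltn.
have Jn : (0 < J <= n.+1)%N.
  rewrite J0 /=; have := @trunc_logP 2 n.+1 isT isT.
  by apply: leq_trans; apply: ltn_expl.
have [K [Cr [l [K0 l0 run poly]]]] : exists K Cr l, [/\ (0 < K)%N, (0 < l)%N,
    forall (w : 'I_m -> R) sigma,
      (forall t, (t < l)%N -> two_flip_step I w (sigma t) (sigma t.+1)) ->
      exists b (cd : {ffun 'I_b -> letter n}), [/\ (0 < b <= l)%N, rich cd Cr K &
        forall a, code_circulation cd K a ->
          `|\sum_i (pair_form I (pairing (code_walk cd) 0 b a) i)%:~R * w i|
            <= K%:R * (objective I w (sigma l) - objective I w (sigma 0%N))] &
    (l * (8 * d * K * (8 * n ^ 3) ^ Cr + 3) <= n ^ ((d + c) * J ^ 3))%N].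
  exists (2 * J + 1)%N, (rich_const J), (block_length n J); split.
  - by rewrite addn1.
  - by rewrite /block_length !muln_gt0.
  - by move=> w sigma stp; have := @run_rich_code R n m d (block_length n J) I w sigma stp J n0 J0 nJ (leqnn _).
  - exact: polyB.
pose rho : R := (8 * n%:R ^+ 3)^-1.
have n3_gt0 : 0 < 8 * n%:R ^+ 3 :> R by rewrite mulr_gt0 // exprn_gt0 // ltr0n.
have rho0 : 0 < rho by rewrite invr_gt0.
have rho1 : rho <= 1.
  rewrite invf_le1 //; apply: (@le_trans _ _ (8 * 1)); first by lra.
  by rewrite ler_wpM2l // exprn_ege1 // ler1n.
(* Chosen so that a pivot interval of length [4 * eta] has probability at most [rho ^+ Cr]. *)
pose eta := rho ^+ Cr / (4 * phi).
have eta0 : 0 < eta by rewrite divr_gt0 ?exprn_gt0 ?mulr_gt0.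
have etaE : 4 * eta * phi = rho ^+ Cr.
  by rewrite /eta; have := lt0r_neq0 phi0; move=> ?; field.
have [B [mB PB HB]] := @bad_event R disp T P n m d I W phi phi0 indepW densW completeI
  Cr K rho eta rho0 rho1 eta0 etaE l n0 (lexx _).
have mU : measurable (\bigcup_i A i) by exact: measurable_finite_union.
have PU : (P (\bigcup_i A i) <= 0)%E.
  apply: le_trans (union_bound P mA) _.
  by rewrite big1 // => i _; have [] := hA i.
have PBU : (P (B `|` \bigcup_i A i) <= (n%:R^-1)%:E)%E.
  by apply: le_trans (measureU2 _ mB mU) _; rewrite -[leRHS]adde0; apply: leeD.
apply: (@le_trans _ _ (P (~` (B `|` \bigcup_i A i)))).
  rewrite probability_setC; last exact: measurableU.
  apply: (@le_trans _ _ (1 - (n%:R^-1)%:E)%E); last by apply: leeB.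
  rewrite -EFinB lee_fin lerD2l lerN2 /harmonic /=.
  rewrite ler_pdivlMr ?ltr0n // mulrC ler_pdivrMr ?ltr0n // -natr1.
  by have : 1 <= n%:R :> R by [rewrite ler1n]; lra.
apply: le_measure; rewrite ?inE.
- by apply: measurableC; apply: measurableU.
- exact: measurable_two_flip_within.
move=> t /= /not_orP[nB nU] tau0 s pths.
have Wt i : -1 <= W i t <= 1.
  apply/negPn/negP => nW; apply: nU; exists i => //.
  by have [_ _ sub] := hA i; apply: sub; apply/negP.
have KR0 : 0 < K%:R :> R by rewrite ltr0n.
have := @path_length R n m d I (fun i => W i t) l (eta / K%:R) tau0 s
  l0 (divr_gt0 eta0 KR0) Wt _ pths.
move=> h; apply: le_trans (h _) _ => {h}.
  (* A block gaining at most [eta / K] would make every form of its rich code small, which happens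
     only on [B]. *)
  move=> sigma stp; rewrite ltNge; apply/negP => small; apply: nB.
  have [b [cd [bl rcd sm]]] := run _ _ stp.
  apply: HB bl rcd _ => // a ca; apply: le_trans (sm a ca) _.
  by rewrite mulrC -ler_pdivlMr.
have := poly; rewrite -(ler_nat R) => /le_trans /(_ (powB n n1)).
move=> h; apply: le_trans (ler_wpM2l _ h); last by rewrite mulr_ge0 ?ltW // ltr0n; apply: leq_ltn_trans (ltn_ord i0).
rewrite (natrM _ l) mulrCA ler_wpM2l //.
rewrite natrD !natrM natrX natrM natrX.
have -> : 2 * (m%:R * d%:R) / (eta / K%:R) = m%:R * phi * (8 * d%:R * K%:R * (8 * n%:R ^+ 3) ^+ Cr).
  rewrite /eta /rho exprVn; field.
  by rewrite !gt_eqF // ?exprn_gt0 // ltr0n.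
have : 1 <= m%:R * phi * 3 by nra.
by rewrite mulrDr; lra.
Qed.
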